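(* Suppose that: (A1) $(X,\mathcal A,\mu)$ is a $\sigma$-finite measure space with $\mu(X)=\infty$, $Y\in\mathcal A$, $\mu(Y)\in(0,\infty)$, and $T$ is a CEMPT on $(X,\mathcal A,\mu)$. (A2) $w_n^Y\sim n^{1-\alpha}\ell(n)$ $(n\to\infty)$ for some $\alpha\in(0,1)$ and some positive, measurable function $\ell:(0,\infty)\to(0,\infty)$ slowly varying at $\infty$. (A3) There exists $N\in\mathbb N$ such that the family $\Big\{\frac{1}{w_n^Y}\sum_{k=0}^{n-1}\hat T^k 1_{Y_k}\Big\}_{n\ge N}$ is uniformly sweeping for $1_Y$. (A4) There exists $H\in L^\infty(\mu)$ such that $\lim_{n\to\infty}\frac{1}{w_n^Y}\sum_{k=0}^{n-1}\hat T^k 1_{Y_k}=H$ in $L^\infty(\mu)$. Let $\{c(n)\}_{n\ge0}$ be a positive-valued sequence satisfying $c(n)\to0$ and $c(n)n\to\infty$ $(n\to\infty)$. Then $$\mu_H\Big(\frac{Z_n^Y}{n}\le c(n)\Big)\sim\frac{\sin(\pi\alpha)}{\pi\alpha}\,\frac{c(n)^\alpha\,\ell(n)}{\ell(c(n)n)}\qquad(n\to\infty).$$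
   Context: $\mathbb N=\{1,2,\dots\}$, $\mathbb N_0=\mathbb N\cup\{0\}$. A measurable map $T:X\to X$ is a CEMPT on a $\sigma$-finite measure space $(X,\mathcal A,\mu)$ with $\mu(X)=\infty$ if it is a conservative, ergodic, measure-preserving transformation. For $0\le u\in L^1(\mu)$, $\mu_u(A)=\int_A u\,d\mu$ $(A\in\mathcal A)$; $\mu_u(\text{condition})$ denotes the $\mu_u$-measure of the set of $x\in X$ satisfying the condition. The transfer operator $\hat T:L^1(\mu)\to L^1(\mu)$ is characterized by $\int_X (v\circ T)u\,d\mu=\int_X v\,(\hat Tu)\,d\mu$ for all $v\in L^\infty(\mu)$, $u\in L^1(\mu)$ (and is extended to all non-negative measurable functions). Uniform sweeping: a family $\mathfrak H$ of non-negative measurable functions on $X$ is uniformly sweeping for a non-negative measurable $G$ if there are $C>0$ and $K\in\mathbb N_0$ such that for every $F\in\mathfrak H$, $C\sum_{k=0}^K\hat T^kF\ge G$ a.e. For positive functions or sequences, $f\sim g$ means $f/g\to1$. A positive measurable $\ell:(0,\infty)\to(0,\infty)$ is slowly varying at $\infty$ if $\ell(\lambda t)\sim\ell(t)$ $(t\to\infty)$ for every $\lambda>0$. First return time: $\varphi(x)=\min\{k\ge1: T^kx\in Y\}$ ($\min\emptyset=\infty$). Set $Y_0=Y$, $Y_n=Y^c\cap\{\varphi=n\}$ $(n\in\mathbb N)$. Wandering rate: $w_n^Y=\mu\big(\bigcup_{k=0}^{n-1}T^{-k}Y\big)=\sum_{k=0}^{n-1}\mu(Y_k)$. Last visit time: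 $Z_n^Y(x)=\max\{0\le k\le n:T^kx\in Y\}$ ($\max\emptyset=0$). *)

(* Defs.v *)
From HB Require Import structures.
From mathcomp Require Import all_boot all_order all_algebra.
From mathcomp Require Import all_classical all_reals all_analysis.
From mathcomp Require Import measurable_realfun.

Set Implicit Arguments.
Unset Strict Implicit.
Unset Printing Implicit Defensive.

Import Order.TTheory GRing.Theory Num.Theory.
Import numFieldNormedType.Exports.

Local Open Scope classical_set_scope.
Local Open Scope ring_scope.

Definition asymp_equiv {U : Type} {R : realType} (F : set_system U)
    (f g : U -> R) : Prop :=
  f x / g x @[x --> F] --> (1 : R).

(* The values of [l] outside of ]0, +oo[ are irrelevant. *)
Definition slowly_varying {R : realType} (l : R -> R) : Prop :=
  [/\ measurable_fun `](0 : R), +oo[ l,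
      forall t, 0 < t -> 0 < l t
    & forall a, 0 < a -> asymp_equiv (+oo : set_system R) (fun t => l (a * t)) l].

Section dynamics.
Context {d : measure_display} {X : measurableType d} {R : realType}.
Variable mu : {measure set X -> \bar R}.
Implicit Types (T : X -> X) (A W Y : set X).

Definition measure_preserving T : Prop :=
  measurable_fun setT T /\ forall A, measurable A -> mu (T @^-1` A) = mu A.

Definition wandering T W : Prop :=
  measurable W /\ trivIset setT (fun n => iter n T @^-1` W).

Definition conservative T : Prop :=
  forall W, wandering T W -> mu W = 0%E.

Definition ergodic T : Prop :=
  forall A, measurable A -> T @^-1` A = A -> mu A = 0%E \/ mu (~` A) = 0%E.

Definition CEMPT T : Prop :=
  [/\ measure_preserving T, conservative T & ergodic T].

(* The measure with density [u] with respect to [mu]. *)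
Definition mu_dens (u : X -> \bar R) A : \bar R :=
  (\int[mu]_(x in A) u x)%E.

(* [That] selects a representative of the a.e.-class of the image under the
   transfer operator of [T], both for integrable functions and for
   non-negative measurable ones; each of the two identities determines
   [That u] up to a null set. *)
Definition transfer_operator T (That : (X -> \bar R) -> X -> \bar R) : Prop :=
  (forall u : X -> \bar R, mu.-integrable setT u ->
     mu.-integrable setT (That u) /\
     forall v : X -> R, v \in Lfun mu +oo%E ->
       (\int[mu]_x ((v (T x))%:E * u x) = \int[mu]_x ((v x)%:E * That u x))%E) /\
  (forall u : X -> \bar R, measurable_fun setT u -> (forall x, (0 <= u x)%E) ->
     [/\ measurable_fun setT (That u), (forall x, (0 <= That u x)%E)
       & forall v : X -> \bar R,
           measurable_fun setT v -> (forall x, (0 <= v x)%E) ->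
           (\int[mu]_x (v (T x) * u x) = \int[mu]_x (v x * That u x))%E]).

Definition uniformly_sweeping (That : (X -> \bar R) -> X -> \bar R)
    (HH : set (X -> \bar R)) (G : X -> \bar R) : Prop :=
  exists2 C : R, 0 < C & exists K : nat, forall F, HH F ->
    {ae mu, forall x, (G x <= C%:E * \sum_(k < K.+1) iter k That F x)%E}.

(* [None] stands for the value +oo, taken when the orbit never returns. *)
Definition first_return T Y (x : X) : option nat :=
  match pselect (exists k, (0 < k)%N && `[< Y (iter k T x) >]) with
  | left ex => Some (ex_minn ex)
  | right _ => None
  end.

Definition level_set T Y (n : nat) : set X :=
  if n is 0%N then Y else ~` Y `&` [set x | first_return T Y x = Some n].

Definition wandering_rate T Y (n : nat) : R :=
  fine (mu (\bigcup_(k < n) (iter k T @^-1` Y))).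

(* The big maximum over an empty range is 0. *)
Definition last_visit T Y (n : nat) (x : X) : nat :=
  \max_(k < n.+1 | `[< Y (iter k T x) >]) k.

Definition transfer_average T (That : (X -> \bar R) -> X -> \bar R) Y (n : nat)
    (x : X) : \bar R :=
  ((wandering_rate T Y n)^-1%:E *
   \sum_(k < n) iter k That (EFin \o \1_(level_set T Y k)) x)%E.

End dynamics.

(* Main.v *)
Require Import Defs.
From HB Require Import structures.
From mathcomp Require Import all_boot all_order all_algebra.
From mathcomp Require Import all_classical all_reals all_analysis.
From mathcomp Require Import measurable_realfun ess_sup_inf.
From mathcomp Require Import ring lra zify.
Import Order.TTheory GRing.Theory Num.Theory.
Import numFieldNormedType.Exports.
Local Open Scope classical_set_scope.
Local Open Scope ring_scope.

(** Put E(i,L) for the set of points whose orbit avoids Y at the times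
    i+1, ..., i+L.  For m = floor(c(n) n) the event of the theorem is
    E(m,n-m).  Let w be the wandering rate, q(i,L) the integral of H over
    E(i,L), and y_n = w_(n+1) - w_n the measure of Y_n.

    Decomposing the points that visit Y during [0,m] and then avoid it up to
    time m+L according to their first entrance time j gives an exact renewal
    equation (level_mass_renewal): w_(m+L+1) - w_L is the sum over j <= m of
    the masses that Y_j gives to T^-j E(m-j,L), that is, of the integrals over
    E(m-j,L) of the j-th power of the transfer operator applied to the
    indicator of Y_j.  Only the averages over j of these densities are known
    to converge, to H; so the equation is summed over m, which turns the
    densities into their partial sums.  Uniform convergence replaces these
    sums by w_k H up to a small multiple of w_k on Y, and uniform sweeping
    bounds the resulting error by the left-hand side itself.  This leaves a
    scalar convolution equation for q and w, with a relative error that is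
    uniform in L (renewal_convolution).

    As y is nonincreasing, for M much smaller than L the left-hand side is
    about y_L M^2/2.  With b = 1 - alpha, the convolution kernel w is close to
    a multiple of the coefficients negbin (1+b) of (1-z)^-(1+b)
    (regular_variation_uniform), and these are inverted exactly by convolution
    with negbin (1-b), because (1-z)^-(1+b) (1-z)^-(1-b) = (1-z)^-2.  What
    remains is twice summed, and second differences together with the
    monotonicity of the events E recover q itself (renewal_asymptotics):
      q(M,n-M) ~ y_n negbin (1+b) M negbin (2-b) M / w_(M+1).
    The monotone density argument of increment_asymp gives
    y_n ~ b w_(n+1)/(n+b), and the product of the two coefficients is
    (M+b)/b times the partial product over k <= M of 1 - alpha^2/k^2, which by
    Euler tends to sin(pi alpha)/(pi alpha).  No Gamma function is involved:
    the constant appears directly as the sine product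
    (euler_sine_product).  The proof is completed by the uniform convergence
    theorem for slowly varying functions (slowly_varying_uniform), used to
    pass between integers and the real numbers c(n) n. *)

(** * Binomial coefficients of negative exponent *)

Section Negbin.
Context {R : realFieldType}.
Implicit Types (a b : R) (u v w : nat -> R) (m n i : nat).

(** The coefficient of z^m in (1-z)^-a.  As a function of m it is a discrete
    version of the power m^(a-1), with exact convolution identities. *)
Definition negbin a m : R := \prod_(k < m) ((a + k%:R) / k.+1%:R).

Definition conv u v m : R := \sum_(i < m.+1) u (m - i)%N * v i.

Lemma negbin0 a : negbin a 0 = 1.
Proof. by rewrite /negbin big_ord0. Qed.

Lemma negbinS a m : negbin a m.+1 = negbin a m * ((a + m%:R) / m.+1%:R).
Proof. by rewrite /negbin big_ord_recr. Qed.

Lemma negbin_gt0 a m : 0 < a -> 0 < negbin a m.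
Proof.
move=> a0; rewrite /negbin; apply: prodr_gt0 => k _.
by rewrite divr_gt0// ltr_wpDr.
Qed.

Lemma negbin_rec a m : (m.+1)%:R * negbin a m.+1 = (a + m%:R) * negbin a m.
Proof. by rewrite negbinS mulrC -mulrA divfK ?pnatr_eq0// mulrC. Qed.

Lemma negbin1 m : negbin 1 m = 1.
Proof.
elim: m => [|m IH]; first by rewrite negbin0.
by rewrite negbinS IH mul1r nat1r divff// pnatr_eq0.
Qed.

Lemma negbin_shift a m : a != 0 -> negbin (a + 1) m = (a + m%:R) / a * negbin a m.
Proof.
move=> a0; elim: m => [|m IH]; first by rewrite !negbin0 addr0 divff ?mulr1.
rewrite !negbinS IH -natr1; field.
by rewrite a0 natr1 pnatr_eq0.
Qed.

Lemma negbin2 m : negbin 2 m = m.+1%:R.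
Proof.
by rewrite -[2]/(1 + 1) negbin_shift ?oner_eq0// negbin1 mulr1 divr1 nat1r.
Qed.

Lemma negbin3 m : negbin 3 m = m.+1%:R * m.+2%:R / 2.
Proof.
have -> : 3 = 2 + 1 :> R by rewrite natr1.
by rewrite negbin_shift ?pnatr_eq0// negbin2 -[m.+2%:R]natr1 -natr1; field.
Qed.

Lemma negbin_pascal a m : negbin (a + 1) m.+1 = negbin (a + 1) m + negbin a m.+1.
Proof.
have [->|a0] := eqVneq a 0.
  by rewrite negbinS !add0r negbin1 nat1r divff ?pnatr_eq0// /negbin
       big_ord_recl /= add0r mul0r mul0r addr0 mulr1.
rewrite !negbin_shift// negbinS -natr1; field.
by rewrite a0 natr1 pnatr_eq0.
Qed.

(** Vandermonde: (1-z)^-a (1-z)^-b = (1-z)^-(a+b).  Both sides satisfy the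
    recursion (m+1) c_(m+1) = (a+b+m) c_m; for the left-hand side, the factor
    m+1 is split as (m+1-i) + i. *)
Lemma conv_vandermonde a b m : conv (negbin a) (negbin b) m = negbin (a + b) m.
Proof.
elim: m => [|m IH]; first by rewrite /conv big_ord1 !negbin0 mulr1.
have m1 : m.+1%:R != 0 :> R by rewrite pnatr_eq0.
apply: (mulfI m1); rewrite negbin_rec -IH /conv.
rewrite [LHS]mulr_sumr (eq_bigr (fun i : 'I_m.+2 =>
    ((m.+1 - i)%N%:R * negbin a (m.+1 - i)) * negbin b i +
    negbin a (m.+1 - i) * (i%:R * negbin b i))); last first.
  move=> i _; have im : (i <= m.+1)%N by rewrite -ltnS ltn_ord.
  have -> : m.+1%:R = (m.+1 - i)%:R + i%:R :> R by rewrite -natrD subnK.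
  ring.
rewrite big_split/= big_ord_recr/= subnn !mul0r addr0.
rewrite [X in _ + X]big_ord_recl/= mul0r mulr0 add0r -big_split mulr_sumr/=.
apply: eq_bigr => i _; have im : (i <= m)%N by rewrite -ltnS ltn_ord.
rewrite /bump/= add1n subSS subSn// !negbin_rec natrB//.
ring.
Qed.

Lemma conv_poly u v N m : (m < N)%N ->
  conv u v m = ((\poly_(i < N) u i) * (\poly_(i < N) v i))`_m.
Proof.
move=> mN; rewrite coefMr; apply: eq_bigr => i _.
by rewrite !coef_poly !ifT//; move: (ltn_ord i); lia.
Qed.

(** Up to degree m, the convolution is the product of truncated polynomials. *)
Lemma convA u v w m : conv u (conv v w) m = conv (conv u v) w m.
Proof.
rewrite !(conv_poly _ _ _ _ (ltnSn m)).
transitivity (((\poly_(i < m.+1) u i) * ((\poly_(i < m.+1) v i)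
    * (\poly_(i < m.+1) w i)))`_m).
  rewrite !coefMr; apply: eq_bigr => i _; congr (_ * _).
  by rewrite coef_poly ltn_ord (conv_poly _ _ m.+1).
rewrite mulrA !coefM; apply: eq_bigr => i _; congr (_ * _).
by rewrite coef_poly ltn_ord (conv_poly _ _ m.+1).
Qed.

Lemma eq_conv u u' v v' m : (forall i, (i <= m)%N -> u i = u' i) ->
  (forall i, (i <= m)%N -> v i = v' i) -> conv u v m = conv u' v' m.
Proof.
move=> uu vv; apply: eq_bigr => i _.
by rewrite uu ?leq_subr// vv// -ltnS ltn_ord.
Qed.

(** The kernel is nonnegative with mass negbin (1+a) m on [0,m], so a uniform
    error is multiplied by at most this mass. *)
Lemma conv_negbin_dist u v a e m : 0 < a ->
  (forall i, (i <= m)%N -> `|u i - v i| <= e) ->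
  `|conv (negbin a) u m - conv (negbin a) v m| <= e * negbin (1 + a) m.
Proof.
move=> a0 uv; rewrite /conv -sumrB.
rewrite addrC -conv_vandermonde /conv mulr_sumr.
apply: (le_trans (ler_norm_sum _ _ _)); apply: ler_sum => i _.
rewrite -mulrBr normrM (gtr0_norm (negbin_gt0 _ _ a0)) negbin1 mulr1 mulrC.
by rewrite ler_pM2r ?negbin_gt0// uv// -ltnS ltn_ord.
Qed.

(** Convolution with negbin 2, that is with m+1, is summing twice; differencing
    twice with step s leaves the sum of u over pairs of offsets below s. *)
Lemma conv_second_diff u m s :
  conv (negbin 2) u (m + s + s)%N - 2 * conv (negbin 2) u (m + s)%N
    + conv (negbin 2) u m = \sum_(i < s) \sum_(j < s) u (m + i + j).+2.
Proof.
pose S1 k := \sum_(i < k.+1) u i.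
have S2 k : conv (negbin 2) u k = \sum_(i < k.+1) S1 i.
  rewrite (_ : negbin 2 = negbin (1 + 1))//.
  under [LHS]eq_bigr do rewrite -conv_vandermonde.
  rewrite -[LHS]/(conv (conv (negbin 1) (negbin 1)) u k) -convA.
  apply: eq_bigr => i _; rewrite negbin1 mul1r.
  by apply: eq_bigr => j _; rewrite negbin1 mul1r.
have S2D k : conv (negbin 2) u (k + s)%N = conv (negbin 2) u k + \sum_(i < s) S1 (k.+1 + i)%N.
  by rewrite !S2 -addSn big_split_ord.
have S1D k : S1 (k + s)%N = S1 k + \sum_(j < s) u (k.+1 + j)%N.
  by rewrite /S1 -addSn big_split_ord.
have E : \sum_(i < s) S1 ((m + s).+1 + i)%N = \sum_(i < s) S1 (m.+1 + i)%N +
    \sum_(i < s) \sum_(j < s) u (m + i + j).+2.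
  rewrite -big_split/=; apply: eq_bigr => i _.
  by rewrite (_ : ((m + s).+1 + i = m.+1 + i + s)%N) ?S1D//; lia.
by rewrite !S2D E; ring.
Qed.

End Negbin.

(** * Power growth of the negative binomial coefficients *)

Section NegbinGrowth.
Context {R : realType}.
Implicit Types (a b x y : R) (m n k : nat).

Lemma powR_div b x y : 0 <= x -> 0 <= y -> (x / y) `^ b = x `^ b / y `^ b.
Proof.
by move=> x0 y0; rewrite powRM ?invr_ge0// -(powR_inv1 y0) -powRrM mulN1r powRN.
Qed.

(** Young's inequality applied to (1+x)^b and 1. *)
Lemma powR_bernoulli b x : 0 < b -> b < 1 -> - 1 <= x -> (1 + x) `^ b <= 1 + b * x.
Proof.
move=> b0 b1 x1; have x10 : 0 <= 1 + x by lra.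
have /(_ _ _ _)/le_trans := @conjugate_powR R ((1 + x) `^ b) 1 b^-1 (1 - b)^-1
  (powR_ge0 _ _) ler01.
rewrite mulr1 !invrK => -> //; first by rewrite invr_gt0.
- by rewrite invr_gt0 subr_gt0.
- ring.
- by rewrite -powRrM mulfV ?gt_eqF// powRr1// powR1 mul1r; lra.
Qed.

Lemma negbin_le a m n : 1 <= a -> (m <= n)%N -> negbin a m <= negbin a n.
Proof.
move=> a1 /subnK <-; elim: (n - m)%N => // k /le_trans; apply.
rewrite addSn negbinS ler_peMr ?(ltW (negbin_gt0 _ _ _))//; first lra.
by rewrite ler_pdivlMr// mul1r -natr1; lra.
Qed.

(** Consecutive ratios (a+k)/(k+1) are at most (k+2)/(k+1). *)
Lemma negbin_sublinear a m n : 0 < a -> a <= 2 -> (m <= n)%N ->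
  negbin a n <= n.+1%:R / m.+1%:R * negbin a m.
Proof.
move=> a0 a2 /subnK <-; elim: (n - m)%N => [|k IH].
  by rewrite add0n divff ?pnatr_eq0// mul1r.
rewrite addSn negbinS.
apply: (le_trans (ler_wpM2r _ IH)).
  by rewrite divr_ge0// addr_ge0// ltW.
set N := (k + m)%N.
rewrite [X in _ <= X](_ : _ = N.+1%:R / m.+1%:R * negbin a m * (N.+2%:R / N.+1%:R)); last first.
  by field; rewrite !nat1r !pnatr_eq0.
rewrite ler_wpM2l//; last by rewrite ler_pM2r// -[N.+2%:R]natr1 -[N.+1%:R]natr1; lra.
by rewrite mulr_ge0// ?divr_ge0// ltW// negbin_gt0.
Qed.

(** Consecutive ratios (a+k)/(k+1) are at least k/(k+1). *)
Lemma negbin_suplinear a m n : 0 < a -> (m <= n)%N ->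
  m%:R * negbin a m <= n%:R * negbin a n.
Proof.
move=> a0 /subnK <-; elim: (n - m)%N => // k /le_trans; apply.
rewrite addSn negbin_rec ler_wpM2r ?(ltW (negbin_gt0 _ _ _))//; lra.
Qed.

(** The finite form of the reflection formula for the Gamma function. *)
Lemma negbin_reflection b m :
  negbin (1 + b) m * negbin (1 - b) m = \prod_(k < m) (1 - b ^+ 2 / k.+1%:R ^+ 2).
Proof.
rewrite /negbin -big_split/=; apply: eq_bigr => k _.
by rewrite -!natr1; field; rewrite natr1 pnatr_eq0.
Qed.

Section exponent.
Variable b : R.
Hypotheses (b0 : 0 < b) (b1 : b < 1).

Let u m := negbin (1 + b) m / m.+1%:R `^ b.

(** Bernoulli's inequality compares the ratio 1 + b/(m+1) with
    (1 + 1/(m+1))^b. *)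
Lemma negbin_ratio_nondecreasing m : u m <= u m.+1.
Proof.
rewrite /u negbinS -mulrA ler_pM2l; last by rewrite negbin_gt0// addr_gt0.
rewrite ler_pdivlMr ?powR_gt0// mulrC -powR_div//.
rewrite (_ : m.+2%:R / m.+1%:R = 1 + m.+1%:R^-1); last first.
  by rewrite -[m.+2%:R]natr1; field; rewrite nat1r pnatr_eq0.
apply: le_trans (powR_bernoulli _ _ b0 b1 _) _.
  by rewrite (@le_trans _ _ 0)// lerN10.
rewrite le_eqVlt; apply/orP; left; apply/eqP; rewrite -natr1; field.
by rewrite natr1 pnatr_eq0.
Qed.

Lemma negbin_lower m : (1 - b) / m.+1%:R `^ b <= negbin (1 - b) m.+1.
Proof.
have b10 : 0 < 1 - b by rewrite subr_gt0.
elim: m => [|m IH].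
  by rewrite negbinS negbin0 powR1 addr0 mul1r.
rewrite negbinS.
have r0 : 0 <= (1 - b + m.+1%:R) / m.+2%:R by rewrite divr_ge0// addr_ge0// ltW.
apply: le_trans (ler_wpM2r r0 IH); rewrite -mulrA ler_pM2l//.
rewrite mulrC ler_pdivlMr ?powR_gt0// mulrC -powR_div//.
rewrite (_ : m.+1%:R / m.+2%:R = 1 + - m.+2%:R^-1); last first.
  by rewrite -[m.+2%:R]natr1; field; rewrite nat1r natr1 pnatr_eq0.
apply: le_trans (powR_bernoulli _ _ b0 b1 _) _.
  by rewrite lerN2 invf_le1// ler1n.
rewrite le_eqVlt; apply/orP; left; apply/eqP.
by rewrite -[m.+2%:R]natr1; field; rewrite nat1r natr1 pnatr_eq0.
Qed.

Lemma negbin_ratio_ge1 m : 1 <= u m.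
Proof.
elim: m => [|m /le_trans]; last by apply; exact: negbin_ratio_nondecreasing.
by rewrite /u negbin0 powR1 divr1.
Qed.

(** The product of negbin (1+b) and negbin (1-b) is at most 1, and the second
    factor is bounded below by a multiple of m^-b. *)
Lemma negbin_ratio_le m : u m <= (1 - b)^-1.
Proof.
have b10 : 0 < 1 - b by rewrite subr_gt0.
apply: (le_trans (negbin_ratio_nondecreasing m)); rewrite /u.
have P1 : negbin (1 + b) m.+1 * negbin (1 - b) m.+1 <= 1.
  rewrite negbin_reflection; apply: prodr_ile1 => k _.
  have k2 : 1 <= k.+1%:R ^+ 2 :> R by rewrite exprn_ege1// ler1n.
  have k20 := lt_le_trans ltr01 k2.
  rewrite subr_ge0 gerBl divr_ge0 ?sqr_ge0// andbT ler_pdivrMr// mul1r.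
  by rewrite (le_trans _ k2)// expr_le1// ltW.
rewrite -(ler_pM2r b10) mulVf ?gt_eqF//.
apply: le_trans P1; rewrite -mulrA ler_pM2l; last by rewrite negbin_gt0// addr_gt0.
apply: le_trans (negbin_lower m); rewrite mulrC ler_pM2l//.
rewrite lef_pV2 ?posrE ?powR_gt0//.
by rewrite ge0_ler_powR ?nnegrE ?ler_nat// ltW.
Qed.

Lemma negbin_powR_cvg : exists2 G : R, 0 < G &
  negbin (1 + b) n / n.+1%:R `^ b @[n --> \oo] --> G.
Proof.
have cu : cvgn u.
  apply: nondecreasing_is_cvgn.
    by apply/nondecreasing_seqP => n; exact: negbin_ratio_nondecreasing.
  by exists (1 - b)^-1 => _ [m _ <-]; exact: negbin_ratio_le.
exists (limn u) => //.
rewrite (@lt_le_trans _ _ 1)//.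
apply: limr_ge => //; apply: nearW => n; exact: negbin_ratio_ge1.
Qed.

Lemma negbin_ratio_powR m n :
  negbin (1 + b) m / negbin (1 + b) n <= (m.+1%:R / n.+1%:R) `^ b / (1 - b).
Proof.
have n0 : 0 < negbin (1 + b) n by rewrite negbin_gt0// addr_gt0.
rewrite ler_pdivrMr//.
have := negbin_ratio_ge1 n; have := negbin_ratio_le m.
rewrite /u ler_pdivrMr ?powR_gt0// => mu nu.
apply: (le_trans mu); rewrite powR_div//.
rewrite [leRHS](_ : _ = (1 - b)^-1 * m.+1%:R `^ b *
  (negbin (1 + b) n / n.+1%:R `^ b)); last by ring.
by rewrite ler_peMr// mulr_ge0 ?powR_ge0// invr_ge0 subr_ge0 ltW.
Qed.

End exponent.
End NegbinGrowth.

(** * The sine product *)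

Section EulerProduct.
Context {R : realType}.
Implicit Types (x y t b : R) (n : nat).

Let mu := @lebesgue_measure R.

(** A form of the fundamental theorem for globally differentiable primitives. *)
Lemma Rintegral_is_derive (f F : R -> R) x y : x < y -> continuous f ->
  (forall t, is_derive t 1 F (f t)) ->
  \int[mu]_(t in `[x, y]) f t = F y - F x.
Proof.
move=> xy cf dF; rewrite /Rintegral (continuous_FTC2 xy (F := F))//.
- exact: continuous_subspaceT.
- have cF : continuous F.
    move=> t; apply/differentiable_continuous; rewrite -derivable1_diffP.
    exact: ex_derive.
  split; first by move=> t _; exact: ex_derive.
  + exact/cvg_at_right_filter/cF.
  + exact/cvg_at_left_filter/cF.
- by move=> t _; rewrite derive1E; exact: derive_val.
Qed.

Definition wallis n y : R :=
  \int[mu]_(t in `[0, pi / 2]) (cos t ^+ n * cos (y * t)).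

Let continuous_cosX n y : continuous (fun t : R => cos t ^+ n * cos (y * t)).
Proof.
move=> t; apply: cvgM.
  by apply: (@continuous_comp _ _ _ cos (fun u => u ^+ n));
    [exact: continuous_cos|exact: exprn_continuous].
apply: (@continuous_comp _ _ _ (fun u => y * u) cos); last exact: continuous_cos.
exact: mulrl_continuous.
Qed.

Let pi2 : 0 < pi / 2 :> R. Proof. by rewrite divr_gt0// pi_gt0. Qed.

Let integrable_cosX n y :
  mu.-integrable `[0, pi / 2] (EFin \o (fun t : R => cos t ^+ n * cos (y * t))).
Proof.
apply: continuous_compact_integrable; first exact: segment_compact.
exact/continuous_subspaceT/continuous_cosX.
Qed.

Let integrableZ_cosX a n y : mu.-integrable `[0, pi / 2]
  (EFin \o (fun t : R => a * (cos t ^+ n * cos (y * t)))).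
Proof.
apply: continuous_compact_integrable; first exact: segment_compact.
apply: continuous_subspaceT => t.
by apply: cvgM; [exact: cvg_cst|exact: continuous_cosX].
Qed.

(** The difference of the two integrands is the derivative of
    n cos^(n-1) t sin t cos(yt) - y cos^n t sin(yt) (with n+2 for n), which
    vanishes at both ends of the interval. *)
Lemma wallis_rec n y :
  (n.+2%:R ^+ 2 - y ^+ 2) * wallis n.+2 y = n.+2%:R * n.+1%:R * wallis n y.
Proof.
apply/eqP; rewrite -subr_eq0; apply/eqP.
rewrite /wallis -!RintegralZl//; try exact: integrable_cosX.
rewrite -RintegralB//; try exact: integrableZ_cosX.
pose F : R -> R := n.+2%:R \*: (cos ^+ n.+1 * sin * (cos \o *%R y)) -
  y \*: (cos ^+ n.+2 * (sin \o *%R y)).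
have dF t : is_derive t 1 F ((n.+2%:R ^+ 2 - y ^+ 2) * (cos t ^+ n.+2 * cos (y * t)) -
    n.+2%:R * n.+1%:R * (cos t ^+ n * cos (y * t))).
  have dy : is_derive t 1 ( *%R y : R -> R) y.
    rewrite -[X in is_derive _ _ _ X]mulr1.
    exact: is_deriveZ.
  apply: is_derive_eq.
  rewrite /GRing.scale/= !fctE/= !exprS.
  have := cos2Dsin2 t; move: (cos t) (sin t) (cos (y * t)) (sin (y * t)) => c s C S cs.
  apply/eqP; rewrite -subr_eq0; apply/eqP.
  transitivity (n.+2%:R * n.+1%:R * c ^+ n * C * (1 - (c ^+ 2 + s ^+ 2))); first ring.
  by rewrite cs subrr mulr0.
rewrite (Rintegral_is_derive _ F _ _ pi2 _ dF).
  by rewrite /F !fctE/= !mulr0 !sin0 cos_pihalf !expr0n/= !(mulr0, mul0r) !scaler0 !subr0.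
move=> t; apply: cvgB; apply: cvgM; try exact: cvg_cst; exact: continuous_cosX.
Qed.

Lemma wallis0_rec n : n.*2.+2%:R * wallis n.+1.*2 0 = n.*2.+1%:R * wallis n.*2 0.
Proof.
have := wallis_rec n.*2 0; rewrite expr0n/= subr0 expr2 -!mulrA.
by move=> /mulfI; apply; rewrite pnatr_eq0.
Qed.

Lemma wallis0_gt0 n : 0 < wallis n.*2 0.
Proof.
elim: n => [|n IH].
  rewrite /wallis (@eq_Rintegral _ _ _ _ _ (fun=> 1)); last first.
    by move=> t _; rewrite expr0 mul0r cos0 mulr1.
  by rewrite Rintegral_cst//= lebesgue_measure_itv/= lte_fin pi2 mul1r/= subr0.
rewrite -(pmulr_rgt0 _ (ltr0Sn R n.*2.+1)) wallis0_rec.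
by rewrite mulr_gt0.
Qed.

Lemma wallis0E y : y != 0 -> wallis 0 y = sin (y * (pi / 2)) / y.
Proof.
move=> y0; rewrite /wallis.
have dF t : is_derive t 1 (y^-1 \*: (sin \o *%R y)) (cos t ^+ 0 * cos (y * t)).
  have dy : is_derive t 1 ( *%R y : R -> R) y.
    by rewrite -[X in is_derive _ _ _ X]mulr1; exact: is_deriveZ.
  by apply: is_derive_eq; rewrite /GRing.scale/= expr0 mul1r mulrC mulfK.
rewrite (Rintegral_is_derive _ _ _ _ pi2 _ dF); last exact: continuous_cosX.
by rewrite !fctE/= mulr0 sin0 scaler0 subr0 /GRing.scale/= mulrC.
Qed.

(** By wallis_rec, each factor 1 - b^2/k^2 is the quotient of two consecutive
    ratios, so the product telescopes down to n = 0. *)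
Lemma wallis_ratio b n : 0 < b < 1 ->
  wallis n.*2 (2 * b) / wallis n.*2 0 * \prod_(k < n) (1 - b ^+ 2 / k.+1%:R ^+ 2)
    = sin (pi * b) / (pi * b).
Proof.
move=> /andP[b0 b1]; elim: n => [|n <-].
  rewrite big_ord0 mulr1 wallis0E; last by rewrite mulf_neq0 ?gt_eqF.
  have -> : wallis 0.*2 0 = pi / 2.
    rewrite /wallis (@eq_Rintegral _ _ _ _ _ (fun=> 1)); last first.
      by move=> t _; rewrite expr0 mul0r cos0 mulr1.
    by rewrite Rintegral_cst//= lebesgue_measure_itv/= lte_fin pi2 mul1r/= subr0.
  have -> : 2 * b * (pi / 2) = pi * b by field.
  move: (pi_gt0 R); move: (@pi R) => p p0; field; rewrite !gt_eqF//.
have := wallis0_gt0 n; have := wallis0_gt0 n.+1.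
have := wallis0_rec n; have := wallis_rec n.*2 (2 * b).
rewrite big_ord_recr/= -[n.+1.*2]/n.*2.+2 -[n.*2.+2]/(n.+1.*2).
set P := \prod_(_ < _) _; set u := wallis _ (2 * b); set v := wallis _ 0.
set u' := wallis _ (2 * b); set v' := wallis _ 0 => eu ev v0 v0'.
have e2 : n.*2.+2%:R = 2 * n.+1%:R :> R by rewrite -natrM mul2n.
have n1 : 0 < n.+1%:R :> R by [].
have m1 : 0 < n.*2.+1%:R :> R by [].
have nb : 0 < n.+1%:R ^+ 2 - b ^+ 2.
  rewrite subr_gt0 ltr_pXn2r ?nnegrE ?ltW//.
  by rewrite (lt_le_trans b1)// ler1n.
move: eu ev; rewrite e2; move: n1 m1 nb.
move: (n.+1%:R) (n.*2.+1%:R) => N M N0 M0 Nb eu ev.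
have {}ev : v = M / (2 * N) * v'.
  apply: (mulfI (x := 2 * N)); first by rewrite mulf_neq0 ?gt_eqF.
  by rewrite ev; field; rewrite gt_eqF.
have {}eu : u = N * M / (2 * (N ^+ 2 - b ^+ 2)) * u'.
  apply: (mulfI (x := (2 * N) ^+ 2 - (2 * b) ^+ 2)).
    by rewrite !exprMn -mulrBr mulf_neq0// gt_eqF.
  by rewrite eu; field; rewrite gt_eqF.
by rewrite eu ev; field; rewrite !gt_eqF.
Qed.

(** Since b < 1, 1 - cos(2bt) = 2 sin^2(bt) is at most
    2 sin^2 t = 2 (1 - cos^2 t); hence the defect is bounded by a difference of
    consecutive Wallis integrals. *)
Lemma wallis_near b n : 0 < b < 1 ->
  1 - n.+1%:R^-1 <= wallis n.*2 (2 * b) / wallis n.*2 0 <= 1.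
Proof.
move=> /andP[b0 b1]; have w0 := wallis0_gt0 n.
have wB : wallis n.*2 0 - wallis n.*2 (2 * b) =
    \int[mu]_(t in `[0, pi / 2]) (cos t ^+ n.*2 * cos (0 * t) - cos t ^+ n.*2 * cos (2 * b * t)).
  by rewrite RintegralB//; exact: integrable_cosX.
have c2 t : 0 <= cos t ^+ n.*2 :> R by rewrite -muln2 exprM sqr_ge0.
rewrite ler_pdivrMr// mul1r ler_pdivlMr//; apply/andP; split; last first.
  rewrite -subr_ge0 wB Rintegral_ge0// => t _.
  by rewrite -mulrBr mulr_ge0// mul0r cos0 subr_ge0 cos_le1.
rewrite mulrBl mul1r lerBlDr -lerBlDl wB.
have -> : n.+1%:R^-1 * wallis n.*2 0 = 2 * (wallis n.*2 0 - wallis n.+1.*2 0).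
  have := wallis0_rec n; set v := wallis _ 0; set v' := wallis _ 0 => ev.
  apply: (mulfI (x := n.*2.+2%:R)); first by rewrite pnatr_eq0.
  rewrite [RHS]mulrCA [X in _ = 2 * X]mulrBr ev.
  have e2 : n.*2.+2%:R = 2 * n.+1%:R :> R by rewrite -natrM mul2n.
  have e1 : n.*2.+1%:R = 2 * n.+1%:R - 1 :> R by rewrite -e2 -[n.*2.+2%:R]natr1 addrK.
  by rewrite e2 e1; field; rewrite nat1r pnatr_eq0.
rewrite /wallis -RintegralB//; try exact: integrable_cosX.
rewrite -RintegralZl//; last first.
  apply: continuous_compact_integrable; first exact: segment_compact.
  apply: continuous_subspaceT => t; apply: cvgB; exact: continuous_cosX.
apply: le_Rintegral => //.
- apply: continuous_compact_integrable; first exact: segment_compact.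
  apply: continuous_subspaceT => t; apply: cvgB; exact: continuous_cosX.
- apply: continuous_compact_integrable; first exact: segment_compact.
  apply: continuous_subspaceT => t; apply: cvgM; first exact: cvg_cst.
  apply: cvgB; exact: continuous_cosX.
move=> t /=; rewrite in_itv/= => /andP[t0 t1].
rewrite -mulrBr mul0r cos0 !mulr1 doubleS !exprS.
rewrite [leRHS](_ : _ = cos t ^+ n.*2 * (2 * (1 - cos t ^+ 2))); last by ring.
rewrite -sin2cos2 ler_wpM2l//.
rewrite (_ : 2 * b * t = (b * t) *+ 2); last by rewrite mulr2n; ring.
rewrite cos_mulr2n cos2sin2 [leLHS](_ : _ = 2 * sin (b * t) ^+ 2); last by ring.
have bt0 : 0 <= b * t by rewrite mulr_ge0// ltW.
have btt : b * t <= t by rewrite ler_piMl// ltW.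
have pp : - (pi / 2) <= 0 :> R by rewrite oppr_le0 ltW.
have sinle : {in `[- (pi / 2), pi / 2] &, {mono (@sin R) : x y / x <= y}}.
  by apply: le_mono_in => x y xI yI; rewrite ltr_sin.
have tI : t \in `[- (pi / 2), pi / 2] by rewrite in_itv/= t1 (le_trans pp).
have btI : b * t \in `[- (pi / 2), pi / 2].
  by rewrite in_itv/= (le_trans btt t1) (le_trans pp).
have zI : 0 \in `[- (pi / 2), pi / 2 : R] by rewrite in_itv/= pp ltW.
have sbt : sin (b * t) <= sin t by rewrite sinle.
have sbt0 : 0 <= sin (b * t) by rewrite -sin0 sinle.
by rewrite ler_pM2l// lerXn2r ?nnegrE// (le_trans sbt0).
Qed.

Lemma euler_sine_product b : 0 < b < 1 ->
  \prod_(k < n) (1 - b ^+ 2 / k.+1%:R ^+ 2) @[n --> \oo] --> sin (pi * b) / (pi * b).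
Proof.
move=> b01; set s := _ / _.
pose Q n := wallis n.*2 (2 * b) / wallis n.*2 0.
have Q1 : Q n @[n --> \oo] --> (1 : R).
  apply: (@squeeze_cvgr _ _ _ _ (fun n => 1 - n.+1%:R^-1) (fun=> 1)).
  - by apply: nearW => n; exact: wallis_near.
  - rewrite -[X in _ --> X]subr0; apply: cvgB; first exact: cvg_cst.
    exact: cvg_harmonic.
  - exact: cvg_cst.
have : s / Q n @[n --> \oo] --> s.
  rewrite -[X in _ --> X](divr1 s); apply: cvgM; first exact: cvg_cst.
  by apply: cvgV => //; exact: oner_neq0.
apply: cvg_trans; apply: near_eq_cvg; near=> n.
rewrite /s -(wallis_ratio b n)// -/(Q n) mulrC mulrA mulVf ?mul1r//.
rewrite gt_eqF//; near: n; apply: cvgr_gt Q1 _ _; exact: ltr01.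
Unshelve. all: by end_near. Qed.

End EulerProduct.

(** * Uniform convergence for slowly varying functions *)

Section UniformConvergence.
Context {R : realType}.
Implicit Types (u v x : R) (n : nat).

Local Notation mu := (@lebesgue_measure R).

(** By uniqueness of Lebesgue measure, as translations preserve the length of
    intervals. *)
Lemma lebesgue_measure_shift u (A : set R) : measurable A ->
  mu ((fun x : R => x - u) @^-1` A) = mu A.
Proof.
move=> mA; pose s : R -> measurableTypeR R := fun x => x - u.
have ms : measurable_fun setT s.
  by apply: measurable_funB => //; exact: measurable_cst.
rewrite -[LHS]/(pushforward mu s A).
apply/esym/lebesgue_measure_unique => //= _ [[a b]] _ <-.
rewrite /pushforward.
have -> : s @^-1` `]a, b] = `]a + u, b + u]%classic.
  by apply/seteqP; split => x /=; rewrite !in_itv/= ltrBrDr lerBlDr.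
rewrite !lebesgue_measure_itv/= !lte_fin ltrD2r.
by case: ifPn => // _; rewrite -!EFinB; congr (_%:E); ring.
Qed.

Section shift_convergence.
Variable h : R -> R.
Hypothesis mh : measurable_fun setT h.
Hypothesis h_cvg : forall u, h (x + u) - h x @[x --> +oo] --> (0 : R).

Let stable (y : nat -> R) (e L : R) n :=
  `[0, L] `&` [set v | forall m, (n <= m)%N -> `|h (y m + v) - h (y m)| < e].

Let stableE y e L n : stable y e L n =
  \bigcap_(m in [set m | (n <= m)%N])
    (`[0, L] `&` ((fun v => h (y m + v) - h (y m)) @^-1` ball (0 : R) e)).
Proof.
apply/seteqP; split => v /=.
  move=> [v0 vs] m /= nm; split => //; rewrite /ball/= sub0r normrN.
  exact: vs.
move=> vs; split; first by have [] := vs n (leqnn n).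
move=> m nm; have [_] := vs m nm.
by rewrite /ball/= sub0r normrN.
Qed.

Let measurable_stable y e L n : measurable (stable y e L n).
Proof.
rewrite stableE; apply: bigcap_measurable => [|m _]; first by exists n => /=.
have mf : measurable_fun setT (fun v => h (y m + v) - h (y m)).
  apply: measurable_funB => //.
  apply: (@measurableT_comp _ _ _ _ _ _ h) => //.
  exact: measurable_funD.
apply: measurableI => //; rewrite -[X in measurable X]setTI; apply: mf => //.
exact: measurable_ball.
Qed.

(** For a divergent sequence y these sets increase to the whole interval. *)
Let stable_large y e L : 0 < e -> 0 < L -> y n @[n --> \oo] --> +oo ->
  forall L', L' < L -> \forall n \near \oo, (L'%:E < mu (stable y e L n))%E.
Proof.
move=> e0 L0 yoo L' L'L.
have U : \bigcup_n stable y e L n = `[0, L]%classic.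
  apply/seteqP; split => v; first by move=> [n _ []].
  move=> v0L.
  have /cvgr0Pnorm_lt /(_ e e0) [N _ NP] : h (y n + v) - h (y n) @[n --> \oo] --> (0 : R).
    exact: (cvg_comp _ _ yoo (h_cvg v)).
  by exists N => //; split => // m /NP.
have := @nondecreasing_cvg_mu _ _ _ mu (stable y e L) (measurable_stable y e L).
rewrite U => /(_ (measurable_itv _)).
have nd : nondecreasing_seq (stable y e L).
  move=> n m nm; apply/subsetPset => v [v0 vs]; split => // k mk.
  by apply: vs; exact: leq_trans nm mk.
move=> /(_ nd).
rewrite [X in _ --> X](_ : _ = L%:E); last first.
  by have := @lebesgue_measure_itv R `[0, L]; rewrite /= lte_fin L0 oppr0 adde0.
move=> cm.
have : \forall x \near nbhs L%:E, (L'%:E < x)%E by apply: open_ereal_gt'; rewrite lte_fin.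
by move=> /cm.
Qed.

(** If the convergence failed at some x_n and shifts u_n, consider the shifts
    v in [0,2L] that are good for x_m for all m >= n, and the shifts in [0,L]
    that are good for x_m + u_m.  For large n they have measure greater than
    3L/2 and L/2, so the first set meets the translate of the second by u_n
    inside [0,2L]; at a common point both estimates contradict the choice of
    u_n. *)
Lemma shift_convergence_uniform (L e : R) : 0 < L -> 0 < e ->
  \forall x \near +oo, forall u, 0 <= u <= L -> `|h (x + u) - h x| < e.
Proof.
move=> L0 e0; apply: contrapT => nn.
have /choice[xu xuP] n : exists xu : R * R, [/\ n%:R < xu.1, 0 <= xu.2 <= L &
    e <= `|h (xu.1 + xu.2) - h xu.1|].
  apply: contrapT => nex; apply: nn; exists n%:R; split => // x nx u uL.
  rewrite ltNge; apply/negP => eh; apply: nex; exists (x, u).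
  by split.
pose x n := (xu n).1; pose u n := (xu n).2; pose y n := x n + u n.
have xoo : x n @[n --> \oo] --> +oo.
  apply: (@ger_cvgy _ _ _ _ (fun n => n%:R)); last exact: cvgr_idn.
  by apply: nearW => n; have [/ltW] := xuP n.
have yoo : y n @[n --> \oo] --> +oo.
  apply: (@ger_cvgy _ _ _ _ x) => //.
  by apply: nearW => n; rewrite lerDl; have [_ /andP[]] := xuP n.
have e20 : 0 < e / 2 by rewrite divr_gt0.
have L20 : 0 < L *+ 2 by rewrite mulrn_wgt0.
have L2L : L / 2 < L by rewrite ltr_pdivrMr// ltr_pMr// ltr1n.
(* the two measures add up to more than 2L *)
have [n [Vn Wn]] : exists n, ((L + L / 2)%:E < mu (stable x (e / 2) (L *+ 2) n))%E /\
    ((L / 2)%:E < mu (stable y (e / 2) L n))%E.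
  have V : \forall n \near \oo, ((L + L / 2)%:E < mu (stable x (e / 2) (L *+ 2) n))%E.
    by apply: stable_large => //; rewrite mulr2n ltrD2l.
  have W : \forall n \near \oo, ((L / 2)%:E < mu (stable y (e / 2) L n))%E.
    by exact: stable_large.
  by near \oo => n; exists n; split; near: n.
pose V := stable x (e / 2) (L *+ 2) n.
pose W := (fun z : R => z - u n) @^-1` stable y (e / 2) L n.
have mW : measurable W.
  rewrite -[X in measurable X]setTI; apply: measurable_funB => //.
have muW : mu W = mu (stable y (e / 2) L n) by exact: lebesgue_measure_shift.
have [_ /andP[u0 uL] eh] := xuP n.
have [z [Vz Wz]] : V `&` W !=set0.
  apply/set0P/negP => /eqP VW0.
  have : (mu (V `|` W) <= mu `[0%R, (L *+ 2)%R])%E.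
    apply: le_measure; rewrite ?inE//.
      by apply: measurableU => //; exact: measurable_stable.
    rewrite subUset; split; first by move=> z [].
    move=> z [/=]; rewrite !in_itv/= mulr2n subr_ge0 lerBlDr => /andP[z0 zL] _.
    by rewrite (le_trans u0 z0)/= (le_trans zL)// lerD2l.
  rewrite [X in (_ <= X)%E]lebesgue_measure_itv/= lte_fin L20 oppr0 adde0.
  have mV : measurable V by exact: measurable_stable.
  have -> : mu (V `|` W) = (mu V + mu W)%E by rewrite measureU.
  rewrite leNgt => /negP; apply.
  have -> : (L *+ 2)%:E = ((L + L / 2)%:E + (L / 2)%:E)%E.
    by rewrite -EFinD; congr EFin; field.
  by rewrite -muW in Wn; exact: lteD.
have [_ /(_ n (leqnn n)) Vz'] := Vz; have [_ /(_ n (leqnn n)) Wz'] := Wz.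
move: eh; rewrite leNgt => /negP; apply.
rewrite -[h (_ + _)]/(h (y n)) -/(x n).
have E : y n + (z - u n) = x n + z by rewrite /y; ring.
rewrite E in Wz'.
rewrite (splitr e) (_ : _ - _ = (h (x n + z) - h (x n)) - (h (x n + z) - h (y n))); last ring.
by apply: le_lt_trans (ler_normB _ _) _; exact: ltrD.
Unshelve. all: by end_near. Qed.

Lemma shift_convergence_uniform_sym (L e : R) : 0 < L -> 0 < e ->
  \forall x \near +oo, forall u, `|u| <= L -> `|h (x + u) - h x| < e.
Proof.
move=> L0 e0; have [M [_ MP]] := shift_convergence_uniform L e L0 e0.
exists (M + L); split; first exact: num_real.
move=> x Mx u; rewrite ler_norml => /andP[uL1 uL2].
have Mx' : M < x by apply: le_lt_trans Mx; rewrite lerDl ltW.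
have [u0|u0] := leP 0 u; first by apply: MP => //; rewrite u0.
have Mxu : M < x + u by rewrite -ltrBlDr; apply: le_lt_trans Mx; rewrite lerD2l lerNl.
have := MP _ Mxu (- u); rewrite addrK oppr_ge0 (ltW u0) lerNl uL1 => /(_ isT).
by rewrite distrC.
Qed.

End shift_convergence.

(** The uniform convergence theorem, from shift_convergence_uniform applied to
    ln of l composed with exp. *)
Lemma slowly_varying_uniform (l : R -> R) : slowly_varying l ->
  forall L e, 1 < L -> 0 < e -> \forall x \near +oo,
    forall a, L^-1 <= a <= L -> `|l (a * x) / l x - 1| < e.
Proof.
move=> [ml l0 lsv] L e L1 e0; have L0 : 0 < L := lt_trans ltr01 L1.
pose h x := ln (l (expR x)).
have mh : measurable_fun setT h.
  have -> : h = @ln R \o (l \o @expR R) by [].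
  apply: measurableT_comp; first exact: measurable_ln.
  apply: (measurable_comp _ _ ml) => //.
  by move=> _ [x _ <-] /=; rewrite in_itv/= andbT expR_gt0.
have hE x u : h (x + u) - h x = ln (l (expR u * expR x) / l (expR x)).
  by rewrite ln_div ?posrE ?l0 ?mulr_gt0 ?expR_gt0// -expRD [u + x]addrC.
have expRy : @expR R x @[x --> +oo] --> +oo.
  apply: (@ger_cvgy _ _ _ _ id) => //; apply: nearW => x.
  by apply: le_trans (expR_ge1Dx x); rewrite lerDr.
have h_cvg u : h (x + u) - h x @[x --> +oo] --> (0 : R).
  rewrite -(@ln1 R); under eq_cvg do rewrite hE.
  apply: (continuous_cvg _ (continuous_ln ltr01)).
  exact: (cvg_comp _ _ expRy (lsv _ (expR_gt0 u))).
have [d d0 dP] : exists2 d : R, 0 < d & forall r, `|r| < d -> `|expR r - 1| < e.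
  have /cvgrPdist_lt/(_ e e0) := @continuous_expR R 0.
  rewrite expR0 => /nbhs_ballP[d /= d0 dP]; exists d => // r rd.
  by rewrite distrC; apply: dP; rewrite /ball/= sub0r normrN.
have lL : 0 < ln L by rewrite ln_gt0.
have [M [_ MP]] := shift_convergence_uniform_sym h mh h_cvg _ _ lL d0.
exists (expR M); split; first exact: num_real.
move=> x Mx a /andP[aL1 aL2].
have a0 : 0 < a by apply: lt_le_trans aL1; rewrite invr_gt0.
have x0 : 0 < x := lt_trans (expR_gt0 M) Mx.
have := MP (ln x) _ (ln a); rewrite hE !lnK ?posrE// => /(_ _ _)/dP.
rewrite lnK ?posrE ?divr_gt0 ?l0 ?mulr_gt0//; apply.
  by rewrite -ltr_expR lnK.
by rewrite ler_norml -lnV// !ler_ln ?posrE ?invr_gt0// aL1.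
Qed.

End UniformConvergence.

(** * Regularly varying sequences against the discrete model *)

Section RegularVariation.
Context {R : realType}.

Lemma perturbed_ratio (k d x y z : R) : 0 < k -> 0 < d -> d <= 4^-1 ->
  `|x - k| <= d * k -> `|y - k| <= d * k -> `|z - 1| <= d ->
  `|x / y * z - 1| <= 5 * d.
Proof.
move=> k0 d0 d4; rewrite !ler_distl => /andP[x1 x2] /andP[y1 y2] /andP[z1 z2].
have y0 : 0 < y by apply: lt_le_trans y1; nra.
have xy1 : x / y <= 1 + 3 * d by rewrite ler_pdivrMr//; nra.
have xy2 : 1 - 3 * d <= x / y by rewrite ler_pdivlMr//; nra.
apply/andP; split; nra.
Qed.

(** Both sequences are regularly varying of index b, so their ratio is slowly
    varying and the bound holds for j >= M/k, with k fixed.  For smaller j both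
    terms are monotone, and at j = M/k they are at most of order k^-b. *)
Lemma regular_variation_uniform (w : nat -> R) (l : R -> R) (b : R) :
  0 < b < 1 -> slowly_varying l -> (forall n, 0 <= w n) -> nondecreasing_seq w ->
  asymp_equiv \oo w (fun n => n%:R `^ b * l n%:R) ->
  forall e : R, 0 < e -> \forall M \near \oo, forall j, (j <= M.*2)%N ->
    `|w j.+1 / w M.+1 - negbin (1 + b) j / negbin (1 + b) M| <= e.
Proof.
move=> /andP[b0 b1] lsv w_ge0 w_nd wl e e0.
have [_ l0 _] := lsv.
have a0 n : 0 < negbin (1 + b) n by rewrite negbin_gt0// addr_gt0.
have [G G0 aG] := negbin_powR_cvg b b0 b1.
pose g n := w n.+1 / negbin (1 + b) n / l n.+1%:R.
have gG : g n @[n --> \oo] --> G^-1.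
  have wl1 : w n.+1 / (n.+1%:R `^ b * l n.+1%:R) @[n --> \oo] --> (1 : R).
    by have := wl; rewrite /asymp_equiv -(cvg_shiftS (fun n => w n / (n%:R `^ b * l n%:R))).
  have aV : (negbin (1 + b) n / n.+1%:R `^ b)^-1 @[n --> \oo] --> G^-1.
    by apply: cvgV => //; rewrite gt_eqF.
  have : w n.+1 / (n.+1%:R `^ b * l n.+1%:R) * (negbin (1 + b) n / n.+1%:R `^ b)^-1
      @[n --> \oo] --> G^-1.
    by rewrite -[X in _ --> X]mul1r; exact: cvgM.
  apply: cvg_trans; apply: near_eq_cvg.
  apply: nearW => n; rewrite /g /=.
  have P0 : n.+1%:R `^ b != 0 :> R by rewrite gt_eqF// powR_gt0.
  have L0 : l n.+1%:R != 0 by rewrite gt_eqF// l0.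
  by field; rewrite P0 L0 gt_eqF.
pose d := Num.min 4^-1 (e / 20).
have d0 : 0 < d by rewrite lt_min invr_gt0 ltr0n/= divr_gt0.
have d4 : d <= 4^-1 by rewrite ge_min lexx.
have de : 20 * d <= e.
  by rewrite mulrC -ler_pdivlMr// ge_min lexx orbT.
(* k is such that the terms with index below M/k contribute at most e/2 *)
pose t := (e * (1 - b) / 2) `^ b^-1.
have t0 : 0 < t by rewrite powR_gt0// divr_gt0// mulr_gt0// subr_gt0.
have [k [k2 kt]] : exists k, (2 <= k)%N /\ 2 / k%:R <= t.
  exists (Num.trunc (2 / t)).+2; split => //.
  rewrite ler_pdivrMr// mulrC -ler_pdivrMr//.
  by rewrite (le_trans (ltW (truncnS_gt _)))// ler_nat.
have k0 : 0 < k%:R :> R by rewrite ltr0n (leq_trans _ k2).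
have ktb : (2 / k%:R) `^ b / (1 - b) <= e / 2.
  have eb : 0 < e * (1 - b) / 2 by rewrite divr_gt0// mulr_gt0// subr_gt0.
  have tb : t `^ b = e * (1 - b) / 2.
    by rewrite /t -powRrM mulVf ?gt_eqF// powRr1// ltW.
  rewrite ler_pdivrMr ?subr_gt0// [leRHS]mulrAC -tb.
  by apply: ge0_ler_powR => //; rewrite ?nnegrE ?divr_ge0// ltW.
have [n1 _ gP] : \forall n \near \oo, `|g n - G^-1| <= d * G^-1.
  have dG : 0 < d * G^-1 by rewrite mulr_gt0 ?invr_gt0.
  have /cvgrPdist_le/(_ _ dG) := gG.
  by apply: filterS => n; rewrite distrC.
have [n2 _ lP] : \forall n \near \oo, forall a : R, (k%:R^-1 <= a <= k%:R) ->
    `|l (a * n.+1%:R) / l n.+1%:R - 1| < d.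
  have k1 : 1 < k%:R :> R by rewrite ltr1n.
  have := slowly_varying_uniform l lsv k%:R d k1 d0.
  have : n.+1%:R @[n --> \oo] --> (+oo : set_system R).
    by rewrite (cvg_shiftS (fun n => n%:R : R)); exact: cvgr_idn.
  by apply.
have gn0 n : (n1 <= n)%N -> 0 < g n.
  move=> /gP /=; rewrite ler_distl => /andP[+ _]; apply: lt_le_trans.
  have : 0 < G^-1 by rewrite invr_gt0.
  nra.
near=> M.
have Mn1 : (k * n1.+1 <= M)%N by near: M; exists (k * n1.+1)%N.
have Mn2 : (n2 <= M)%N by near: M; exists n2.
have Mk : (k <= M)%N by near: M; exists k.
have kp : (0 < k)%N by exact: leq_trans k2.
have n1M : (n1 <= M)%N.
  by apply: leq_trans Mn1; rewrite (leq_trans (leqnSn _))// leq_pmull.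
have w0 : 0 < w M.+1.
  have := gn0 _ n1M; rewrite /g => h.
  rewrite lt_neqAle w_ge0 andbT; apply: contraTN h => /eqP <-.
  by rewrite !mul0r ltxx.
have main j : (M.+1 <= k * j.+1)%N -> (j <= M.*2)%N ->
    `|w j.+1 / w M.+1 - negbin (1 + b) j / negbin (1 + b) M| <= e / 2.
  move=> Mj jM; have n1j : (n1 <= j)%N.
    rewrite -ltnS -(ltn_pmul2l kp); apply: leq_trans Mj.
    by rewrite ltnS (leq_trans _ Mn1)// leq_mul2l leqnSn orbT.
  have M1 : 0 < M.+1%:R :> R by [].
  have lj : `|l j.+1%:R / l M.+1%:R - 1| <= d.
    have := lP M Mn2 (j.+1%:R / M.+1%:R); rewrite divfK ?pnatr_eq0// => h.
    apply/ltW/h/andP; split.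
      by rewrite ler_pdivlMr// mulrC ler_pdivrMr// -natrM mulnC ler_nat.
    rewrite ler_pdivrMr// -natrM ler_nat (@leq_trans (2 * M.+1))//.
      by clear -jM; lia.
    by rewrite leq_mul2r k2 orbT.
  have gj := gP _ n1j; have gM := gP _ n1M.
  have G0' : 0 < G^-1 by rewrite invr_gt0.
  have := perturbed_ratio _ _ _ _ _ G0' d0 d4 gj gM lj => pr.
  rewrite (_ : _ - _ = negbin (1 + b) j / negbin (1 + b) M *
      (g j / g M * (l j.+1%:R / l M.+1%:R) - 1)); last first.
    rewrite /g; field.
    by rewrite !gt_eqF ?a0 ?l0.
  have aa0 : 0 <= negbin (1 + b) j / negbin (1 + b) M by rewrite divr_ge0// ltW.
  rewrite normrM (ger0_norm aa0).
  have a2 : negbin (1 + b) j / negbin (1 + b) M <= 2.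
    rewrite ler_pdivrMr//.
    have [jM'|jM'] := leqP M j.
      apply: le_trans (negbin_sublinear (1 + b) _ _ _ _ jM') _.
      - by rewrite addr_gt0.
      - by rewrite -[2]/(1 + 1) lerD2l ltW.
      - by rewrite ler_pM2r// ler_pdivrMr// -natrM ler_nat; clear -jM; lia.
    apply: (@le_trans _ _ (negbin (1 + b) M)).
      by apply: negbin_le; [rewrite lerDl ltW|exact: ltnW].
    by rewrite ler_peMl ?ler1n// ltW.
  apply: (@le_trans _ _ (2 * (5 * d))); last by lra.
  by rewrite ler_pM.
move=> j jM; have [jk|jk] := leqP M.+1 (k * j.+1)%N.
  by apply: le_trans (main _ jk jM) _; lra.
pose i := (M %/ k)%N.
have ik : (M.+1 <= k * i.+1)%N by rewrite mulnC ltn_ceil// (leq_trans _ k2).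
have ki : (k * i <= M)%N by rewrite mulnC leq_trunc_div.
have ji : (j <= i)%N.
  by rewrite leq_divRL// mulnC -ltnS (leq_ltn_trans _ jk)// leq_mul2l leqnSn orbT.
have iM : (i <= M.*2)%N by rewrite (leq_trans (leq_div _ _))// -addnn leq_addl.
have := main i ik iM; rewrite ler_distl => /andP[_ mi].
have ai : negbin (1 + b) i / negbin (1 + b) M <= e / 2.
  apply: le_trans (negbin_ratio_powR b b0 b1 i M) (le_trans _ ktb).
  rewrite ler_pM2r ?invr_gt0 ?subr_gt0//.
  rewrite ge0_ler_powR ?nnegrE ?divr_ge0//; first exact: ltW.
  rewrite ler_pdivrMr// mulrAC ler_pdivlMr// -!natrM ler_nat mulnC mulnS.
  by clear -ki Mk; move: (k * i)%N ki => z; lia.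
have aj : negbin (1 + b) j / negbin (1 + b) M <= negbin (1 + b) i / negbin (1 + b) M.
  by rewrite ler_pM2r ?invr_gt0// negbin_le// lerDl ltW.
have aj0 : 0 <= negbin (1 + b) j / negbin (1 + b) M by rewrite divr_ge0// ltW.
have wj : w j.+1 / w M.+1 <= w i.+1 / w M.+1.
  by rewrite ler_pM2r ?invr_gt0// w_nd.
have wj0 : 0 <= w j.+1 / w M.+1 by rewrite divr_ge0// ltW.
by rewrite ler_distl; apply/andP; split; lra.
Unshelve. all: by end_near. Qed.

End RegularVariation.

(** * Increments of concave regularly varying sequences *)

Section ConcaveRate.
Context {R : realType}.
Variables (w : nat -> R) (b : R).
Hypotheses (b0 : 0 < b) (b1 : b < 1).
Hypothesis w_gt0 : forall n, 0 < w n.+1.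

Let y n := w n.+1 - w n.
Hypothesis y_ge0 : forall n, 0 <= y n.
Hypothesis y_noninc : forall m n, (m <= n)%N -> y n <= y m.
Hypothesis w_negbin : forall e : R, 0 < e -> \forall M \near \oo,
  forall j, (j <= M.*2)%N ->
    `|w j.+1 / w M.+1 - negbin (1 + b) j / negbin (1 + b) M| <= e.

Let a := negbin (1 + b).
Let r := negbin b.

Let a_gt0 n : 0 < a n. Proof. by rewrite negbin_gt0// addr_gt0. Qed.
Let r_gt0 n : 0 < r n. Proof. exact: negbin_gt0. Qed.

Lemma increments_sum (u : nat -> R) n s :
  u (n + s)%N - u n = \sum_(i < s) (u (n + i).+1 - u (n + i)%N).
Proof.
elim: s => [|s IH]; first by rewrite addn0 subrr big_ord0.
by rewrite big_ord_recr/= -IH addnS; ring.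
Qed.

Let aD n s : a (n + s)%N - a n = \sum_(i < s) r (n + i).+1.
Proof.
rewrite increments_sum; apply: eq_bigr => i _.
by rewrite /a [1 + b]addrC negbin_pascal /r; ring.
Qed.

Let r_noninc m n : (m <= n)%N -> r n <= r m.
Proof.
move=> /subnK <-; elim: (n - m)%N => // k IH.
apply: le_trans IH; rewrite addSn /r negbinS ler_piMr ?(ltW (r_gt0 _))//.
by rewrite ler_pdivrMr// mul1r -natr1 addrC lerD2l ltW.
Qed.

Lemma sum_ge_cst (u : nat -> R) s c : (forall i, (i < s)%N -> c <= u i) ->
  s%:R * c <= \sum_(i < s) u i.
Proof.
move=> uc; rewrite mulr_natl -[X in _ *+ X](card_ord s) -sumr_const.
by apply: ler_sum => i _; exact: uc.
Qed.

Lemma sum_le_cst (u : nat -> R) s c : (forall i, (i < s)%N -> u i <= c) ->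
  \sum_(i < s) u i <= s%:R * c.
Proof.
move=> uc; rewrite mulr_natl -[X in _ *+ X](card_ord s) -sumr_const.
by apply: ler_sum => i _; exact: uc.
Qed.

(** A monotone density theorem: y_n lies between the averages of the increments
    of w over blocks of length s = n/k before and after n.  Up to an error
    proportional to k d, these are the averages for the model sequence, whose
    increments are the explicit negbin b. *)
Lemma increment_asymp : y n * (n%:R + b) / w n.+1 @[n --> \oo] --> b.
Proof.
suff H : y n * a n / (w n.+1 * r n) @[n --> \oo] --> (1 : R).
  have : y n * a n / (w n.+1 * r n) * b @[n --> \oo] --> b.
    by rewrite -[X in _ --> X]mul1r; apply: cvgM => //; exact: cvg_cst.
  apply: cvg_trans; apply: near_eq_cvg; apply: nearW => n /=.
  have r0 := r_gt0 n; have w0 := w_gt0 n.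
  rewrite /a [1 + b]addrC negbin_shift ?gt_eqF// -/(r n).
  by field; rewrite !gt_eqF.
apply/cvgrPdist_le => e e0.
have [k [ke k2]] : exists k, 2 / e <= k%:R - 1 /\ (1 < k)%N.
  exists (Num.trunc (2 / e)).+2; split => //.
  by rewrite -[X in _ <= X - 1]natr1 addrK ltW// truncnS_gt.
have kp : (0 < k)%N by exact: ltnW.
have k1 : 1 < k%:R :> R by rewrite ltr1n.
pose d := e * b / (8 * k%:R).
have d0 : 0 < d by rewrite divr_gt0 ?mulr_gt0// ltr0n.
have [N _ NP] := w_negbin d d0.
near=> n.
have nN : (N <= n)%N by near: n; exists N.
have nk : (k <= n)%N by near: n; exists k.
have {NP}D := NP n nN.
(* blocks of length s, with n/(2k) <= s <= n/k *)
pose s := (n %/ k)%N.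
have sk : (s * k <= n)%N by exact: leq_trunc_div.
have sk2 : (n <= 2 * (s * k))%N.
  have : (0 < s)%N by rewrite divn_gt0.
  by have := divn_eq n k; have := ltn_pmod n kp; rewrite -/s; nia.
have s0 : (0 < s)%N by rewrite divn_gt0.
have sn : (s < n)%N.
  by apply: leq_trans sk; rewrite ltn_Pmulr ?divn_gt0.
have Rs0 : 0 < s%:R :> R by rewrite ltr0n.
have Rn0 : 0 < n%:R :> R by rewrite ltr0n (leq_ltn_trans _ sn).
have Rsk : s%:R * k%:R <= n%:R :> R by rewrite -natrM ler_nat.
have Rsk2 : n%:R <= 2 * (s%:R * k%:R) :> R by rewrite -!natrM ler_nat.
have an0 := a_gt0 n; have wn0 := w_gt0 n; have rn0 := r_gt0 n.
have anE : a n = (b + n%:R) / b * r n by rewrite /a [1 + b]addrC negbin_shift ?gt_eqF.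
have err : d * a n <= s%:R * (e / 2) * r n.
  rewrite anE [leLHS]mulrA ler_pM2r// /d.
  rewrite [leLHS](_ : _ = e * (b + n%:R) / (8 * k%:R)); last first.
    by field; rewrite !gt_eqF// (lt_trans ltr01).
  rewrite ler_pdivrMr; last by rewrite mulr_gt0// (lt_trans ltr01).
  have n1 : 1 <= n%:R :> R by rewrite ler1n (leq_ltn_trans _ sn).
  have : b + n%:R <= 4 * (s%:R * k%:R) by have := b1; lra.
  by move=> h; rewrite [leRHS](_ : _ = e * (4 * (s%:R * k%:R))) ?ler_pM2l//; field.
have up : y n * a n <= (1 + e) * (w n.+1 * r n).
  have h1 : s%:R * y n <= w n.+1 - w (n - s).+1.
    have := increments_sum w (n - s).+1 s; rewrite addSn subnK ?(ltnW sn)// => ->.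
    apply: (sum_ge_cst (fun i => y ((n - s).+1 + i)%N)) => i si.
    by apply: (y_noninc ((n - s).+1 + i)%N n); clear -si sn; lia.
  have h2 : a n - a (n - s)%N <= s%:R * (n%:R / (n%:R - s%:R) * r n).
    have := aD (n - s)%N s; rewrite subnK ?(ltnW sn)// => ->.
    apply: (sum_le_cst (fun i => r (n - s + i).+1)) => i si.
    apply: (@le_trans _ _ (r (n - s)%N)); first by apply: r_noninc; clear -si sn; lia.
    have ns0 : 0 < n%:R - s%:R :> R by rewrite subr_gt0 ltr_nat.
    rewrite mulrAC ler_pdivlMr// mulrC -natrB ?(ltnW sn)//.
    by apply: negbin_suplinear => //; clear -si sn; lia.
  have h3 : w n.+1 - w (n - s).+1 <= w n.+1 * ((a n - a (n - s)%N) / a n + d).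
    have := D (n - s)%N; rewrite ler_distl => /(_ _)/andP[|+ _]; first by clear -sn; lia.
    rewrite -/a ler_pdivlMr// => h; rewrite mulrBl divff ?gt_eqF//; lra.
  have h4 : n%:R / (n%:R - s%:R) <= 1 + e / 2.
    rewrite ler_pdivrMr ?subr_gt0 ?ltr_nat//.
    suff : s%:R <= e / 2 * (n%:R - s%:R) by lra.
    have : 2 <= e * (k%:R - 1) by rewrite mulrC -ler_pdivrMr.
    nra.
  rewrite -(ler_pM2l Rs0) mulrA.
  have : w n.+1 * ((a n - a (n - s)%N) / a n + d) * a n <=
         s%:R * ((1 + e) * (w n.+1 * r n)).
    rewrite [leLHS](_ : _ = w n.+1 * ((a n - a (n - s)%N) + d * a n)); last first.
      by field; rewrite gt_eqF.
    rewrite [leRHS](_ : _ = w n.+1 * (s%:R * (1 + e / 2) * r n + s%:R * (e / 2) * r n)); last first.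
      by field.
    rewrite ler_pM2l//; apply: lerD; last exact: err.
    by apply: (le_trans h2); rewrite -[leRHS]mulrA ler_pM2l// ler_pM2r.
  apply: le_trans; rewrite ler_pM2r//.
  exact: le_trans h1 h3.
have lo : (1 - e) * (w n.+1 * r n) <= y n * a n.
  have h1 : w (n + s).+1 - w n.+1 <= s%:R * y n.
    have := increments_sum w n.+1 s; rewrite addSn => ->.
    apply: (sum_le_cst (fun i => y (n.+1 + i)%N)) => i si.
    by apply: (y_noninc n (n.+1 + i)%N); clear -si sn; lia.
  have h2 : s%:R * (n%:R / (n%:R + s%:R) * r n) <= a (n + s)%N - a n.
    rewrite aD; apply: (sum_ge_cst (fun i => r (n + i).+1)) => i si.
    apply: (@le_trans _ _ (r (n + s)%N)); last by apply: r_noninc; clear -si sn; lia.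
    rewrite mulrAC ler_pdivrMr ?addr_gt0// [leRHS]mulrC -natrD.
    by apply: negbin_suplinear => //; clear -si sn; lia.
  have h3 : w n.+1 * ((a (n + s)%N - a n) / a n - d) <= w (n + s).+1 - w n.+1.
    have := D (n + s)%N; rewrite ler_distl => /(_ _)/andP[|+ _]; first by clear -sn; lia.
    rewrite -/a ler_pdivlMr// => h; rewrite mulrBl divff ?gt_eqF//; lra.
  have h4 : 1 - e / 2 <= n%:R / (n%:R + s%:R).
    rewrite ler_pdivlMr ?addr_gt0//.
    suff : s%:R <= e / 2 * (n%:R + s%:R) by lra.
    have : 2 <= e * (k%:R - 1) by rewrite mulrC -ler_pdivrMr.
    nra.
  rewrite -(ler_pM2l Rs0) [leRHS]mulrA.
  have : s%:R * ((1 - e) * (w n.+1 * r n)) <=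
      w n.+1 * ((a (n + s)%N - a n) / a n - d) * a n.
    rewrite [leRHS](_ : _ = w n.+1 * ((a (n + s)%N - a n) - d * a n)); last first.
      by field; rewrite gt_eqF.
    rewrite [leLHS](_ : _ = w n.+1 * (s%:R * (1 - e / 2) * r n - s%:R * (e / 2) * r n)); last first.
      by field.
    rewrite ler_pM2l//; apply: lerB; last exact: err.
    by apply: le_trans h2; rewrite -[leLHS]mulrA ler_pM2l// ler_pM2r.
  move=> /le_trans; apply; rewrite ler_pM2r//.
  exact: le_trans h3 h1.
have wr0 : 0 < w n.+1 * r n by rewrite mulr_gt0.
by rewrite distrC ler_distl ler_pdivlMr// ler_pdivrMr// lo.
Unshelve. all: by end_near. Qed.

(** By increment_asymp, y_n is about b w_(n+1)/(n+b), and w is nondecreasing. *)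
Lemma increment_stable (e : R) : 0 < e -> exists k, (0 < k)%N /\ forall m n,
  (k <= n)%N -> (n <= m)%N -> (k * (m - n) <= n)%N -> (1 - e) * y n <= y m.
Proof.
move: (b0) (b1) => hb0 hb1 e0.
pose d := Num.min (e * b / 4) (b / 2).
have d0 : 0 < d by rewrite lt_min !divr_gt0// mulr_gt0.
have d1 : d <= e * b / 4 by rewrite ge_min lexx.
have d2 : d <= b / 2 by rewrite ge_min lexx orbT.
have /cvgrPdist_le/(_ _ d0)[N _ NP] := increment_asymp.
pose k0 := (Num.trunc (2 / e)).+1.
have k0e : 2 / e <= k0%:R by rewrite ltW// truncnS_gt.
exists (maxn N k0); split; first by rewrite leq_max orbT.
move=> m n; rewrite geq_max => /andP[Nn kn] nm mn.
have := NP n Nn; have := NP m (leq_trans Nn nm).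
rewrite /= !ler_distlC => /andP[]; rewrite ler_pdivlMr// => m1 _ /andP[_].
rewrite ler_pdivrMr// => n1.
have wmn : w n.+1 <= w m.+1.
  rewrite -subr_ge0 -(subnK nm) addnC -addSn increments_sum sumr_ge0// => i _.
  exact: y_ge0.
have h : (m%:R - n%:R) * 2 <= e * n%:R :> R.
  have : k0%:R * (m%:R - n%:R) <= n%:R :> R.
    rewrite -natrB// -natrM ler_nat (leq_trans _ mn)// leq_mul// leq_maxr//.
  have : 2 <= e * k0%:R by rewrite mulrC -ler_pdivrMr.
  have : n%:R <= m%:R :> R by rewrite ler_nat.
  nra.
have n0 : 0 <= n%:R :> R by [].
have nm' : n%:R <= m%:R :> R by rewrite ler_nat.
have mb : 0 < m%:R + b :> R by rewrite ltr_wpDl.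
rewrite -(ler_pM2r mb).
have y0 := y_ge0 n; have w0 := w_gt0 n.
apply: le_trans m1.
have bd : 0 <= b - d by lra.
apply: (@le_trans _ _ ((b - d) * w n.+1)); last by rewrite ler_wpM2l.
have [e1|e1] := leP 1 e.
  apply: (@le_trans _ _ 0); last by rewrite mulr_ge0// ltW.
  by rewrite mulr_le0_ge0 ?(ltW mb)// mulr_le0_ge0// subr_le0.
have : (1 - e) * (b + d) <= (b - d) * (1 - e / 2) by nra.
have : (1 - e / 2) * (m%:R + b) <= n%:R + b by nra.
move=> h1 h2.
have e2 : 0 < 1 - e / 2 by lra.
rewrite -(ler_pM2r e2).
apply: (@le_trans _ _ ((1 - e) * (y n * (n%:R + b)))).
  rewrite [leLHS](_ : _ = (1 - e) * (y n * ((1 - e / 2) * (m%:R + b)))); last by ring.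
  by rewrite ler_wpM2l ?subr_ge0 ?(ltW e1)// ler_wpM2l.
apply: (@le_trans _ _ ((1 - e) * ((b + d) * w n.+1))).
  by rewrite ler_wpM2l// subr_ge0 ltW.
by rewrite [leLHS]mulrA [leRHS]mulrAC ler_pM2r.
Qed.

(** The increments y_n are at least of order 1/n, so w_(2n) - w_n cannot tend
    to 0. *)
Lemma concave_rate_cvgy : w n @[n --> \oo] --> +oo.
Proof.
have w_nd : nondecreasing_seq w.
  by apply/nondecreasing_seqP => n; rewrite -subr_ge0; exact: y_ge0.
apply: nondecreasing_dvgn_lt => // cw.
have w1 := w_gt0 0.
have b20 : 0 < b / 2 by rewrite divr_gt0.
have d0 : 0 < b / 2 / 3 * w 1 by rewrite !mulr_gt0// invr_gt0.
have /cvgrPdist_le/(_ _ b20)[N1 _ NP1] := increment_asymp.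
have d20 : 0 < b / 2 / 3 * w 1 / 4 by rewrite divr_gt0.
have /cvgrPdist_le/(_ _ d20)[N2 _ NP2] := cw.
pose n := (maxn N1 N2).+1.
have N1n : (N1 <= n)%N by rewrite leqW// leq_maxl.
have N2n : (N2 <= n)%N by rewrite leqW// leq_maxr.
have N1nn : (N1 <= n + n)%N by rewrite (leq_trans N1n)// leq_addr.
have N2nn : (N2 <= n + n)%N by rewrite (leq_trans N2n)// leq_addr.
have n1 : 1 <= n%:R :> R by rewrite ler1n.
have ub : w (n + n)%N - w n <= b / 2 / 3 * w 1 / 2.
  have := NP2 _ N2n; have := NP2 _ N2nn; rewrite /= !ler_distlC.
  move=> /andP[_ h1] /andP[h2 _].
  rewrite [leRHS](_ : _ = (limn w + b / 2 / 3 * w 1 / 4) - (limn w - b / 2 / 3 * w 1 / 4)).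
    exact: lerB.
  by field.
have lb : n%:R * y (n + n)%N <= w (n + n)%N - w n.
  rewrite increments_sum; apply: (sum_ge_cst (fun i => y (n + i)%N)) => i ni.
  by apply: y_noninc; rewrite leq_add2l ltnW.
have := NP1 _ N1nn; rewrite /= ler_distlC => /andP[+ _].
rewrite ler_pdivlMr// natrD => h.
have w1n : w 1 <= w (n + n).+1 by exact: w_nd.
have y0 := y_ge0 (n + n)%N; have hb1 := b1; have hb0 := b0.
have h2 : b / 2 * w 1 <= 3 * (n%:R * y (n + n)%N).
  apply: (@le_trans _ _ ((b - b / 2) * w (n + n).+1)).
    by rewrite (_ : b - b / 2 = b / 2) ?ler_pM2l//; field.
  apply: (le_trans h); rewrite mulrA mulrC ler_wpM2r//; lra.
have : b / 2 / 3 * w 1 <= b / 2 / 3 * w 1 / 2.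
  apply: (le_trans _ (le_trans lb ub)).
  by rewrite mulrAC ler_pdivrMr// [leRHS]mulrC.
by rewrite leNgt => /negP; apply; rewrite gtr_pMr// invf_lt1// ltr1n.
Qed.

End ConcaveRate.

(** * From the renewal equation to a scalar convolution *)

Section RenewalConvolution.
Context {R : realType}.
Variables (w : nat -> R) (sigma : nat -> nat -> nat -> R) (q qY : nat -> nat -> R).
Hypothesis w_ge0 : forall n, 0 <= w n.
Hypothesis w_nd : nondecreasing_seq w.
Hypothesis w_cvgy : w n @[n --> \oo] --> +oo.
Hypothesis sigma0 : forall i L, sigma 0 i L = 0.
Hypothesis sigma_nd : forall i L m n, (m <= n)%N -> sigma m i L <= sigma n i L.
Hypothesis sigma_bound : forall n i L, sigma n i L <= n%:R * qY i L.
Hypothesis q_ge0 : forall i L, 0 <= q i L.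
Hypothesis qY_ge0 : forall i L, 0 <= qY i L.
Hypothesis q_bound : exists B, forall i L, q i L <= B * qY i L.
Hypothesis sigma_q : forall e, 0 < e -> exists n0, forall n, (n0 <= n)%N ->
  forall i L, `|sigma n i L - w n * q i L| <= e * w n * qY i L.
Hypothesis sigma_sweep : exists C K N, 0 < C /\ forall n, (N <= n)%N -> forall i L,
  w n * qY i L <= C * \sum_(k < K.+1) sigma n (i + k)%N L.
Hypothesis renewal : forall m L,
  \sum_(j < m.+1) (sigma j.+1 (m - j)%N L - sigma j (m - j)%N L) = w (m + L).+1 - w L.

(** The left-hand side of the renewal equation, summed over m. *)
Definition cumulated_rate M L : R := \sum_(m < M.+1) (w (m + L).+1 - w L).
Local Notation V := cumulated_rate.

Let sigma_ge0 n i L : 0 <= sigma n i L.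
Proof. by rewrite -(sigma0 i L); exact: sigma_nd. Qed.

(** Summing the renewal equation over m replaces the terms of index j by their
    partial sums sigma. *)
Lemma cumulated_renewal M L : V M L = \sum_(i < M.+1) sigma (M - i).+1 i L.
Proof.
rewrite /V; elim: M => [|M IH].
  by rewrite !big_ord1 -renewal big_ord1 sigma0 subr0.
rewrite big_ord_recr/= IH -renewal [X in _ + X](reindex_inj rev_ord_inj)/=.
rewrite [X in _ + X](eq_bigr (fun i : 'I_M.+2 =>
  sigma (M.+1 - i).+1 i L - sigma (M.+1 - i)%N i L)); last first.
  move=> i _; rewrite subSS.
  by have -> : (M.+1 - (M.+1 - i) = i)%N by rewrite subKn// -ltnS.
rewrite sumrB [X in _ + (_ - X)]big_ord_recr/= subnn sigma0 addr0.
rewrite [X in _ + (_ - X)](eq_bigr (fun i : 'I_M.+1 => sigma (M - i).+1 i L)).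
  by rewrite addrC subrK.
by move=> i _; rewrite subSn// -ltnS.
Qed.

Lemma cumulated_rate_ge0 M L : 0 <= V M L.
Proof. by rewrite cumulated_renewal sumr_ge0. Qed.

Lemma cumulated_rate_nd L M M' : (M <= M')%N -> V M L <= V M' L.
Proof.
move=> /subnKC <-; rewrite /V -addSn big_split_ord/= lerDl sumr_ge0// => i _.
by rewrite subr_ge0 w_nd// ltnW// ltnS leq_addl.
Qed.

(** Sweeping bounds w_n qY by values of sigma at times shifted by at most K;
    summed along the convolution these are bounded by the cumulated rate. *)
Lemma swept_mass : exists C K N, 0 < C /\ forall P M L, (N <= P)%N ->
  \sum_(i < M.+1) w (M - i + P)%N * qY i L <= C * V (M + P + K)%N L.
Proof.
have [C [K [N [C0 sw]]]] := sigma_sweep.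
exists (C * K.+1%:R), K, N.+1; split; first by rewrite mulr_gt0.
move=> P M L NP.
have P0 : (0 < P)%N by exact: leq_ltn_trans NP.
apply: (@le_trans _ _ (\sum_(i < M.+1) C * \sum_(k < K.+1) sigma (M - i + P)%N (i + k)%N L)).
  apply: ler_sum => i _; apply: sw.
  by rewrite (leq_trans (ltnW NP))// leq_addl.
rewrite -mulr_sumr -mulrA ler_pM2l// exchange_big/=.
apply: (@le_trans _ _ (\sum_(k < K.+1) V (M + P + K)%N L)); last first.
  by rewrite sumr_const card_ord mulr_natl.
apply: ler_sum => k _.
apply: (@le_trans _ _ (V (M + P.-1 + k)%N L)); last first.
  apply: cumulated_rate_nd; apply: leq_add; last by rewrite -ltnS.
  by rewrite leq_add2l leq_pred.
rewrite cumulated_renewal.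
have -> : (M + P.-1 + k).+1 = (k + (M.+1 + P.-1))%N by clear; lia.
rewrite big_split_ord big_split_ord/=.
apply: (@le_trans _ _ (\sum_(i < M.+1) sigma (M + P.-1 + k - (k + i)).+1 (k + i)%N L)).
  apply: ler_sum => i _; rewrite [(i + k)%N]addnC.
  rewrite (_ : (M + P.-1 + k - (k + i)).+1 = (M - i + P)%N)//.
  by have := ltn_ord i; clear -P0; lia.
by rewrite ler_wpDl ?sumr_ge0// lerDl sumr_ge0.
Qed.

(** The hypothesis on sigma and q controls the error when the index is large;
    for bounded indices it is at most B qY.  Shifting the argument of w by P, so
    large that B is at most d w_P, makes swept_mass apply to both parts. *)
Lemma renewal_convolution (e : R) : 0 < e -> exists P, forall M L,
  `|V M L - conv (fun j => w j.+1) (q^~ L) M| <= e * V (M + P)%N L.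
Proof.
move=> e0; have [C [K [N [C0 sw]]]] := swept_mass.
have [B0 qB] := q_bound.
pose d := e / (2 * C).
have d0 : 0 < d by rewrite divr_gt0// mulr_gt0.
have [n0 sq] := sigma_q d d0.
pose B := n0%:R + w n0 * Num.max 0 B0.
have B_ge0 : 0 <= B by rewrite addr_ge0// mulr_ge0// le_max lexx.
have sqB n i L : `|sigma n i L - w n * q i L| <= (d * w n + B) * qY i L.
  have [n0n|nn0] := leqP n0 n.
    by apply: le_trans (sq _ n0n i L) _; rewrite ler_wpM2r// lerDl.
  have s1 : sigma n i L <= n0%:R * qY i L.
    by apply: le_trans (sigma_bound n i L) _; rewrite ler_wpM2r// ler_nat ltnW.
  have s2 : w n * q i L <= w n0 * Num.max 0 B0 * qY i L.
    rewrite -mulrA ler_pM//; first by rewrite w_nd// ltnW.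
    by apply: le_trans (qB i L) _; rewrite ler_wpM2r// le_max lexx orbT.
  apply: le_trans (ler_normB _ _) _; rewrite !ger0_norm ?mulr_ge0//.
  apply: le_trans (lerD s1 s2) _; rewrite -mulrDl -/B ler_wpM2r// lerDr.
  by rewrite mulr_ge0// ltW.
have [P1 _ wP] : \forall n \near \oo, B / d <= w n by exact: (cvgryPge _).1.
pose P := (maxn P1 N).+1.
have NP : (N <= P)%N by rewrite /P leqW// leq_maxr.
have BP : B <= d * w P.
  by rewrite mulrC -ler_pdivrMr//; apply: wP => /=; rewrite /P leqW// leq_maxl.
exists (P + K)%N => M L; rewrite cumulated_renewal /conv -sumrB.
apply: le_trans (ler_norm_sum _ _ _) _.
apply: (@le_trans _ _ (\sum_(i < M.+1) (2 * d) * (w (M - i + P)%N * qY i L))).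
  apply: ler_sum => i _; apply: le_trans (sqB _ _ _) _.
  rewrite [leRHS]mulrA ler_wpM2r// (_ : 2 * d = d + d); last by ring.
  rewrite mulrDl lerD//.
    by rewrite ler_pM2l// w_nd// /P addnS ltnS leq_addr.
  by apply: le_trans BP _; rewrite ler_pM2l// w_nd// leq_addl.
rewrite -mulr_sumr; apply: le_trans (ler_wpM2l _ (sw P M L NP)) _.
  by rewrite mulr_ge0// ltW.
rewrite addnA mulrA ler_wpM2r ?cumulated_rate_ge0//.
by rewrite /d le_eqVlt; apply/orP; left; apply/eqP; field; rewrite gt_eqF.
Qed.

End RenewalConvolution.

(** * Inverting the convolution *)

Section RenewalAsymptotics.
Context {R : realType}.
Variables (w : nat -> R) (b : R) (q : nat -> nat -> R).
Hypotheses (b0 : 0 < b) (b1 : b < 1).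
Hypothesis w_gt0 : forall n, 0 < w n.+1.
Hypothesis w_nd : nondecreasing_seq w.
Let y n := w n.+1 - w n.
Hypothesis y_noninc : forall m n, (m <= n)%N -> y n <= y m.
Hypothesis w_negbin : forall e : R, 0 < e -> \forall M \near \oo,
  forall j, (j <= M.*2)%N ->
    `|w j.+1 / w M.+1 - negbin (1 + b) j / negbin (1 + b) M| <= e.
Hypothesis q_ge0 : forall i L, 0 <= q i L.
Hypothesis q_homo : forall i i' L L', (i <= i')%N -> (i' + L' <= i + L)%N ->
  q i L <= q i' L'.
Hypothesis q_conv : forall e : R, 0 < e -> exists P, forall M L,
  `|cumulated_rate w M L - conv (fun j => w j.+1) (q^~ L) M|
    <= e * cumulated_rate w (M + P)%N L.

Let y_ge0 n : 0 <= y n.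
Proof. by rewrite subr_ge0 w_nd. Qed.

Let a_gt0 n : 0 < negbin (1 + b) n.
Proof. by rewrite negbin_gt0// addr_gt0. Qed.

Let r_gt0 n : 0 < negbin (2 - b) n.
Proof. by rewrite negbin_gt0// subr_gt0 (lt_trans b1)// ltr1n. Qed.

Let rho M := w M.+1 / negbin (1 + b) M.

Let rho_gt0 M : 0 < rho M.
Proof. by rewrite divr_gt0. Qed.

Lemma negbin3_ge0 M : 0 <= negbin (3 : R) M.
Proof. exact/ltW/negbin_gt0. Qed.

Lemma negbin3_nd m M : (m <= M)%N -> negbin (3 : R) m <= negbin 3 M.
Proof. by apply: negbin_le; rewrite ler1n. Qed.

Lemma negbin3_scale M : negbin (3 : R) (4 * M)%N <= 16 * negbin 3 M.
Proof.
rewrite !negbin3 -[_.+2%:R]natr1 -[_.+1%:R]natr1 -[M.+2%:R]natr1 -[M.+1%:R]natr1 natrM.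
by have := ler0n R M; nra.
Qed.

Lemma sum_succ M : \sum_(m < M.+1) m.+1%:R = negbin (3 : R) M.
Proof.
elim: M => [|M IH]; first by rewrite big_ord1 negbin0.
rewrite big_ord_recr/= IH (_ : 3 = 2 + 1); last by rewrite natr1.
by rewrite negbin_pascal negbin2.
Qed.

Let rateE m L : w (m + L).+1 - w L = \sum_(i < m.+1) y (L + i)%N.
Proof. by rewrite addnC -addnS increments_sum. Qed.

Lemma cumulated_rate_le M L : cumulated_rate w M L <= y L * negbin 3 M.
Proof.
rewrite -sum_succ mulr_sumr; apply: ler_sum => m _; rewrite rateE mulrC.
apply: (sum_le_cst (fun i => y (L + i)%N)) => i _.
by apply: y_noninc; exact: leq_addr.
Qed.

Lemma cumulated_rate_ge M L : y (L + M)%N * negbin 3 M <= cumulated_rate w M L.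
Proof.
rewrite -sum_succ mulr_sumr; apply: ler_sum => m _; rewrite rateE mulrC.
apply: (sum_ge_cst (fun i => y (L + i)%N)) => i im.
apply: y_noninc; rewrite leq_add2l -ltnS (leq_trans im)//.
Qed.

(** The increments of w between L and L+m are nearly constant, and the shift by
    P in the error term is absorbed by 16 = 4^2, as m+P <= 4M. *)
Lemma conv_rate_close (e : R) : 0 < e -> exists k, forall M L m,
  (k <= M)%N -> (k * M <= L)%N -> (m <= 3 * M)%N ->
  `|conv (fun j => w j.+1) (q^~ L) m - y L * negbin 3 m| <= e * (y L * negbin 3 M).
Proof.
move=> e0; have e32 : 0 < e / 32 by rewrite divr_gt0.
have [P qP] := q_conv _ e32.
have [k1 [k10 yk]] := increment_stable w b b0 b1 w_gt0 y_ge0 y_noninc w_negbin _ e32.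
exists (maxn P.+1 (3 * k1)) => M L m kM ML mM.
have PM : (P <= M)%N by rewrite (leq_trans _ kM)// leq_max leqnSn.
have M0 : (0 < M)%N by rewrite (leq_trans _ kM)// leq_max.
have kML : (3 * k1 * M <= L)%N.
  by rewrite (leq_trans _ ML)// leq_mul2r leq_maxr orbT.
have kL : (k1 <= L)%N.
  by rewrite (leq_trans _ kML)// mulnAC leq_pmull// muln_gt0.
have kmL : (k1 * m <= L)%N.
  rewrite (leq_trans _ kML)// (@leq_trans (k1 * (3 * M)))//.
    by rewrite leq_mul2l mM orbT.
  by rewrite mulnCA mulnA.
have r3m : negbin (3 : R) m <= 16 * negbin 3 M.
  apply: le_trans (negbin3_scale M); apply: negbin3_nd.
  by rewrite (leq_trans mM)// leq_mul2r orbT.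
have r3mP : negbin (3 : R) (m + P)%N <= 16 * negbin 3 M.
  apply: le_trans (negbin3_scale M); apply: negbin3_nd.
  by rewrite -[4%N]/(3 + 1)%N mulnDl mul1n leq_add.
have r0 := negbin3_ge0 m.
have yL0 := y_ge0 L.
have A1 := qP m L.
have A2 : e / 32 * cumulated_rate w (m + P)%N L <= e / 2 * (y L * negbin 3 M).
  apply: le_trans (ler_wpM2l (ltW e32) (cumulated_rate_le _ _)) _.
  have := ler_wpM2l yL0 r3mP.
  set u := y L * _; set v := negbin _ M => h.
  rewrite [leRHS](_ : _ = e / 32 * (y L * (16 * v))); last by field.
  by rewrite ler_pM2l.
have A3 : `|cumulated_rate w m L - y L * negbin 3 m| <= e / 2 * (y L * negbin 3 M).
  rewrite distrC ger0_norm ?subr_ge0 ?cumulated_rate_le//.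
  apply: (@le_trans _ _ ((y L - y (L + m)%N) * negbin 3 m)).
    by rewrite [leRHS]mulrBl lerD2l lerN2 cumulated_rate_ge.
  have yy : y L - y (L + m)%N <= e / 32 * y L.
    have := yk (L + m)%N L kL (leq_addr _ _); rewrite addKn => /(_ kmL).
    by rewrite mulrBl mul1r => h; rewrite lerBlDr addrC -lerBlDr.
  apply: le_trans (ler_wpM2r r0 yy) _.
  rewrite [leRHS](_ : _ = e / 32 * y L * (16 * negbin 3 M)); last by field.
  by rewrite ler_wpM2l// mulr_ge0// ltW.
rewrite (_ : _ - _ = (cumulated_rate w m L - y L * negbin 3 m) -
  (cumulated_rate w m L - conv (fun j => w j.+1) (q^~ L) m)); last by ring.
apply: le_trans (ler_normB _ _) _.
rewrite [X in _ <= X * _]splitr [leRHS]mulrDl lerD//.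
exact: le_trans A1 A2.
Qed.

(** The kernel w is replaced by a multiple of negbin (1+b).  The error is a
    multiple of w_(M+1) times the plain sum of q, which is at most the
    convolution of w and q at m+M. *)
Lemma conv_negbin_close (e : R) : 0 < e -> exists k, forall M L m,
  (k <= M)%N -> (k * M <= L)%N -> (m <= M.*2)%N ->
  `|rho M * conv (negbin (1 + b)) (q^~ L) m - y L * negbin 3 m|
    <= e * (y L * negbin 3 M).
Proof.
move=> e0; have e2 : 0 < e / 2 by rewrite divr_gt0.
have [k1 H1] := conv_rate_close _ e2.
have [k2 H2] := conv_rate_close 1 ltr01.
(* 34 = 2 * 17, as the convolution of w and q at m+M is at most 17 times the
   main term *)
pose d := e / 34; have d0 : 0 < d by rewrite divr_gt0.
have [k3 _ H3] := w_negbin d d0.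
exists (maxn (maxn k1 k2) k3) => M L m; rewrite !geq_max => /andP[/andP[k1M k2M] k3M].
move=> kL m2M.
have k1L : (k1 * M <= L)%N.
  by rewrite (leq_trans _ kL)// leq_mul2r -maxnA leq_maxl orbT.
have k2L : (k2 * M <= L)%N.
  by rewrite (leq_trans _ kL)// leq_mul2r maxnAC leq_maxr orbT.
have m3M : (m <= 3 * M)%N by clear -m2M; lia.
have mM3M : (m + M <= 3 * M)%N by clear -m2M; lia.
have A1 := H1 M L m k1M k1L m3M.
have A2 : conv (fun j => w j.+1) (q^~ L) (m + M)%N <= 17 * (y L * negbin 3 M).
  have := H2 M L _ k2M k2L mM3M; rewrite mul1r ler_distl => /andP[_ h].
  apply: (le_trans h).
  have : y L * negbin 3 (m + M)%N <= y L * (16 * negbin 3 M).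
    rewrite ler_wpM2l//; apply: le_trans (negbin3_scale M); apply: negbin3_nd.
    by rewrite (leq_trans mM3M)// leq_mul2r orbT.
  lra.
have A3 : `|rho M * conv (negbin (1 + b)) (q^~ L) m - conv (fun j => w j.+1) (q^~ L) m|
    <= d * conv (fun j => w j.+1) (q^~ L) (m + M)%N.
  rewrite /conv !mulr_sumr -sumrB; apply: le_trans (ler_norm_sum _ _ _) _.
  apply: (@le_trans _ _ (\sum_(i < m.+1) d * (w (m + M - i).+1 * q i L))); last first.
    rewrite -(addSn m M) big_split_ord/= lerDl sumr_ge0// => i _.
    by rewrite !mulr_ge0// ?ltW.
  apply: ler_sum => i _ /=.
  rewrite [X in `|X - _|]mulrA -mulrBl normrM (ger0_norm (q_ge0 _ _)) mulrA.
  rewrite ler_wpM2r//.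
  apply: (@le_trans _ _ (d * w M.+1)); last first.
    rewrite ler_pM2l// w_nd// ltnS -addnBAC ?leq_addl//.
    by rewrite -ltnS.
  have jM : (m - i <= M.*2)%N by rewrite (leq_trans (leq_subr _ _)).
  have := H3 M k3M _ jM; rewrite distrC.
  have W0 := w_gt0 M.
  rewrite (_ : rho M * _ - _ =
    (negbin (1 + b) (m - i)%N / negbin (1 + b) M - w (m - i).+1 / w M.+1) * w M.+1).
    by rewrite normrM (gtr0_norm W0) ler_pM2r.
  by rewrite /rho; field; rewrite !gt_eqF.
rewrite (_ : _ - _ = (rho M * conv (negbin (1 + b)) (q^~ L) m
      - conv (fun j => w j.+1) (q^~ L) m) +
  (conv (fun j => w j.+1) (q^~ L) m - y L * negbin 3 m)); last by ring.
apply: le_trans (ler_normD _ _) _.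
rewrite [X in _ <= X * _]splitr [leRHS]mulrDl lerD//.
apply: le_trans A3 _; apply: le_trans (ler_wpM2l (ltW d0) A2) _.
by rewrite le_eqVlt; apply/orP; left; apply/eqP; rewrite /d; field.
Qed.

Lemma conv_scale (u v : nat -> R) c m : conv u (fun i => c * v i) m = c * conv u v m.
Proof. by rewrite /conv mulr_sumr; apply: eq_bigr => i _; rewrite mulrCA. Qed.

(** Convolution with negbin (1-b) turns negbin (1+b) into negbin 2, and negbin 3
    into negbin (4-b), the convolution of negbin 2 and negbin (2-b). *)
Lemma double_sum_close (e : R) : 0 < e -> exists k, forall M L m,
  (k <= M)%N -> (k * M <= L)%N -> (m <= M.*2)%N ->
  `|rho M * conv (negbin 2) (q^~ L) m - y L * conv (negbin 2) (negbin (2 - b)) m|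
    <= e * (y L * M%:R ^+ 2 * negbin (2 - b) M).
Proof.
move=> e0; have e6 : 0 < e / 6 by rewrite divr_gt0.
have [k H] := conv_negbin_close _ e6.
exists k.+1 => M L m kM kML mM.
have kM' : (k <= M)%N by exact: ltnW.
have kML' : (k * M <= L)%N by rewrite (leq_trans _ kML)// leq_mul2r leqnSn orbT.
have M1 : 1 <= M%:R :> R by rewrite ler1n (leq_ltn_trans _ kM).
have b1' : 0 < 1 - b by rewrite subr_gt0.
have := conv_negbin_dist (fun j => rho M * conv (negbin (1 + b)) (q^~ L) j)
  (fun j => y L * negbin 3 j) (1 - b) (e / 6 * (y L * negbin 3 M)) m b1'.
have Hm i : (i <= m)%N -> `|rho M * conv (negbin (1 + b)) (q^~ L) i - y L * negbin 3 i|
    <= e / 6 * (y L * negbin 3 M).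
  by move=> im; apply: H => //; exact: leq_trans mM.
move=> /(_ Hm); rewrite !conv_scale convA.
have E1 : conv (conv (negbin (1 - b)) (negbin (1 + b))) (q^~ L) m = conv (negbin 2) (q^~ L) m.
  apply: eq_conv => // i _; rewrite conv_vandermonde; congr negbin; ring.
have E2 : conv (negbin (1 - b)) (negbin 3) m = conv (negbin 2) (negbin (2 - b)) m.
  by rewrite !conv_vandermonde; congr negbin; ring.
have E3 : 1 + (1 - b) = 2 - b by ring.
rewrite E1 E2 E3 => /le_trans; apply.
have r2 : negbin (2 - b) m <= 2 * negbin (2 - b) M.
  apply: (@le_trans _ _ (negbin (2 - b) M.*2)).
    by apply: negbin_le => //; have := b1; lra.
  apply: le_trans (negbin_sublinear (2 - b) M M.*2 _ _ _) _.
  - by have := b1; lra.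
  - by have := b0; lra.
  - by rewrite -addnn leq_addl.
  rewrite ler_pM2r// ler_pdivrMr// -natrM ler_nat; clear; lia.
have r3 : negbin 3 M <= 3 * M%:R ^+ 2 :> R.
  rewrite negbin3 -[M.+2%:R]natr1 -[M.+1%:R]natr1; nra.
have y0 := y_ge0 L.
apply: (@le_trans _ _ (e / 6 * (y L * (3 * M%:R ^+ 2)) * (2 * negbin (2 - b) M))).
  apply: ler_pM => //; first by rewrite !mulr_ge0 ?negbin3_ge0// ltW.
    exact: ltW.
  by rewrite ler_pM2l// ler_wpM2l.
by rewrite le_eqVlt; apply/orP; left; apply/eqP; field.
Qed.

(** Second differences with step s of double_sum_close. *)
Lemma block_sum_close (e : R) : 0 < e -> exists k, forall M L m s,
  (k <= M)%N -> (k * M <= L)%N -> (m + s + s <= M.*2)%N ->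
  `|rho M * \sum_(i < s) \sum_(j < s) q (m + i + j).+2 L -
    y L * \sum_(i < s) \sum_(j < s) negbin (2 - b) (m + i + j).+2|
    <= e * (y L * M%:R ^+ 2 * negbin (2 - b) M).
Proof.
move=> e0; have e4 : 0 < e / 4 by rewrite divr_gt0.
have [k H] := double_sum_close _ e4; exists k => M L m s kM kML msM.
have H1 := H M L _ kM kML msM.
have H2 : `|_| <= _ := H M L _ kM kML (leq_trans (leq_addr s _) msM).
have H3 : `|_| <= _ := H M L m kM kML _.
have {}H3 := H3 (leq_trans (leq_trans (leq_addr s _) (leq_addr s _)) msM).
rewrite -(conv_second_diff (q^~ L)) -conv_second_diff.
move: H1 H2 H3; rewrite !ler_norml => /andP[? ?] /andP[? ?] /andP[? ?].
apply/andP; split; lra.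
Qed.

Lemma block_le (u : nat -> R) m s c : (forall i, (m <= i <= m + s + s)%N -> u i <= c) ->
  \sum_(i < s) \sum_(j < s) u (m + i + j).+2 <= s%:R ^+ 2 * c.
Proof.
move=> uc; rewrite expr2 -mulrA.
apply: (sum_le_cst (fun i => \sum_(j < s) u (m + i + j).+2)) => i si.
apply: (sum_le_cst (fun j => u (m + i + j).+2)) => j sj; apply: uc.
by clear -si sj; lia.
Qed.

Lemma block_ge (u : nat -> R) m s c : (forall i, (m <= i <= m + s + s)%N -> c <= u i) ->
  s%:R ^+ 2 * c <= \sum_(i < s) \sum_(j < s) u (m + i + j).+2.
Proof.
move=> uc; rewrite expr2 -mulrA.
apply: (sum_ge_cst (fun i => \sum_(j < s) u (m + i + j).+2)) => i si.
apply: (sum_ge_cst (fun j => u (m + i + j).+2)) => j sj; apply: uc.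
by clear -si sj; lia.
Qed.

(** By monotonicity of the avoidance events, q M (n-M) is at most every
    q i (n-2M) with M <= i <= 2M, and at least every q i n with i <= M.
    Averaging over blocks of length of order M/K above and below M and
    applying block_sum_close gives matching bounds: negbin (2-b) varies by a
    factor 1 + O(1/K) over the block, and the error of block_sum_close, of order
    K^2 d after division by s^2, is made small by the choice of d. *)
Lemma renewal_asymptotics (e : R) : 0 < e -> exists k, forall M n,
  (k <= M)%N -> (k * M <= n)%N ->
  `|rho M * q M (n - M)%N - y n * negbin (2 - b) M| <= e * (y n * negbin (2 - b) M).
Proof.
move=> e0.
have [K [K4 Ke]] : exists K, (4 <= K)%N /\ 8 / e <= K%:R.
  exists (Num.trunc (8 / e)).+4; split => //.
  rewrite (le_trans (ltW (truncnS_gt _)))// ler_nat.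
  exact: leqW (leqW (leqnSn _)).
have Kp : (0 < K)%N by exact: leq_trans K4.
have K0 : 0 < K%:R :> R by rewrite ltr0n.
(* M^2 is at most 4 K^2 s^2, which costs the factor 4 K^2 below *)
pose d := e / (16 * K%:R ^+ 2).
have d0 : 0 < d by rewrite divr_gt0// mulr_gt0// exprn_gt0.
have [k1 H1] := block_sum_close d d0.
(* f is such that (1 + e) (1 - f) = 1 + e - e/4 *)
pose f := e / (4 * (1 + e)).
have f0 : 0 < f by rewrite divr_gt0// mulr_gt0// addr_gt0.
have [k2 [k20 yk]] := increment_stable w b b0 b1 w_gt0 y_ge0 y_noninc w_negbin _ f0.
exists (maxn K (k1 + k2.+1 * 2).+2) => M n; rewrite geq_max => /andP[KM kM] kn.
have {}kn : ((k1 + k2.+1 * 2).+2 * M <= n)%N.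
  by rewrite (leq_trans _ kn)// leq_mul2r leq_maxr orbT.
have Mp : (0 < M)%N by exact: leq_trans KM.
pose s := (M %/ K)%N.
have s0 : (0 < s)%N by rewrite divn_gt0.
have sKM : (s * K <= M)%N by exact: leq_trunc_div.
have MsK : (M <= 2 * (s * K))%N.
  have := divn_eq M K; have := ltn_pmod M Kp; rewrite -/s => h1 h2.
  have h3 : (K <= s * K)%N by rewrite leq_pmull.
  by move: h1 h2 h3; move: (s * K)%N (M %% K)%N; clear => *; lia.
have s4 : (4 * s <= M)%N by rewrite (leq_trans _ sKM)// mulnC leq_mul2l K4 orbT.
have Rs0 : 0 < s%:R :> R by rewrite ltr0n.
have Rs20 : 0 < s%:R ^+ 2 :> R by rewrite exprn_gt0.
have RM0 : 0 < M%:R :> R by rewrite ltr0n.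
have RsK : s%:R * K%:R <= M%:R :> R by rewrite -natrM ler_nat.
have RMs : M%:R <= 2 * (s%:R * K%:R) :> R by rewrite -!natrM ler_nat.
have r0 := r_gt0 M.
have dM : d * M%:R ^+ 2 <= e / 4 * s%:R ^+ 2.
  have : M%:R ^+ 2 <= (2 * (s%:R * K%:R)) ^+ 2 :> R.
    by rewrite ler_pXn2r ?nnegrE// ?mulr_ge0.
  move=> /(ler_wpM2l (ltW d0)) /le_trans; apply.
  by rewrite le_eqVlt; apply/orP; left; apply/eqP; rewrite /d; field; rewrite gt_eqF.
have sM2 : 2 * s%:R / M.+1%:R <= e / 4.
  rewrite ler_pdivrMr// -natr1.
  have : 8 <= e * K%:R by rewrite mulrC -ler_pdivrMr.
  nra.
have err L : d * (y L * M%:R ^+ 2 * negbin (2 - b) M) <=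
    s%:R ^+ 2 * (e / 4 * (y L * negbin (2 - b) M)).
  rewrite [leLHS](_ : _ = d * M%:R ^+ 2 * (y L * negbin (2 - b) M)); last by ring.
  rewrite [leRHS](_ : _ = e / 4 * s%:R ^+ 2 * (y L * negbin (2 - b) M)); last by ring.
  by rewrite ler_wpM2r// mulr_ge0// ltW.
have y0 := y_ge0 n.
have b2 : 1 <= 2 - b by have := b1; lra.
have b2' : 2 - b <= 2 by have := b0; lra.
have bpos : 0 < 2 - b by have := b1; lra.
have nM : (M.*2 <= n)%N.
  by rewrite (leq_trans _ kn)// -mul2n leq_mul2r orbT.
have MnM : (M <= n)%N by rewrite (leq_trans _ nM)// -addnn leq_addr.
have lower : (1 - e) * (y n * negbin (2 - b) M) <= rho M * q M (n - M)%N.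
  have k1M : (k1 <= M)%N by clear -kM; lia.
  have k1n : (k1 * M <= n)%N.
    by rewrite (leq_trans _ kn)// leq_mul2r; apply/orP; right; clear; lia.
  have ms : (M - 2 * s + s + s <= M.*2)%N by clear -s4; lia.
  have := H1 M n (M - 2 * s)%N s k1M k1n ms.
  rewrite ler_distl => /andP[+ _].
  have B1 : \sum_(i < s) \sum_(j < s) q (M - 2 * s + i + j).+2 n <= s%:R ^+ 2 * q M (n - M)%N.
    apply: (block_le (q^~ n)) => i /andP[i1 i2]; apply: q_homo; first by clear -i2 s4; lia.
    by rewrite subnKC// leq_addl.
  have B2 : s%:R ^+ 2 * ((1 - e / 4) * negbin (2 - b) M) <=
      \sum_(i < s) \sum_(j < s) negbin (2 - b) (M - 2 * s + i + j).+2.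
    apply: block_ge => i /andP[i1 i2].
    apply: (@le_trans _ _ (negbin (2 - b) (M - 2 * s)%N)); last exact: negbin_le.
    have := negbin_sublinear (2 - b) _ _ bpos b2' (leq_subr (2 * s) M).
    rewrite mulrAC ler_pdivlMr// => h.
    have M1 : 0 < M.+1%:R :> R by [].
    rewrite -(ler_pM2r M1) [leRHS]mulrC; apply: le_trans h.
    rewrite [leLHS]mulrAC mulrC ler_pM2l//.
    have : 2 * s%:R <= e / 4 * M.+1%:R by rewrite -ler_pdivrMr.
    have -> : (M - 2 * s).+1%:R = M.+1%:R - 2 * s%:R :> R.
      rewrite -natrM -natrB; last by clear -s4; lia.
      by congr (_%:R); clear -s4; lia.
    by move=> *; lra.
  move=> h.
  have := ler_wpM2l (ltW (rho_gt0 M)) B1; have := ler_wpM2l y0 B2; have := err n.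
  move=> h1 h2 h3; rewrite -(ler_pM2l Rs20).
  have h4 : y n * (s%:R ^+ 2 * ((1 - e / 4) * negbin (2 - b) M)) -
      s%:R ^+ 2 * (e / 4 * (y n * negbin (2 - b) M)) <= rho M * (s%:R ^+ 2 * q M (n - M)%N).
    apply: le_trans h3; apply: le_trans h; exact: lerB.
  rewrite [leRHS]mulrCA; apply: le_trans h4.
  rewrite [leRHS](_ : _ = s%:R ^+ 2 * ((1 - e / 2) * (y n * negbin (2 - b) M))); last by field.
  rewrite ler_pM2l// ler_wpM2r//; first by rewrite mulr_ge0// ltW.
  by rewrite lerD2l lerN2 ler_pdivrMr// ler_peMr ?ler1n// ltW.
have upper : rho M * q M (n - M)%N <= (1 + e) * (y n * negbin (2 - b) M).
  pose L := (n - M.*2)%N.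
  have nL : n = (L + M.*2)%N by rewrite /L subnK.
  have LM : ((k1 + k2.+1 * 2) * M <= L)%N.
    by rewrite /L leq_subRL// -mul2n -mulnDl add2n.
  have k1M : (k1 <= M)%N by clear -kM; lia.
  have k1L : (k1 * M <= L)%N.
    by rewrite (leq_trans _ LM)// leq_mul2r leq_addr orbT.
  have k2L : (k2 * (n - L) <= L)%N.
    rewrite (leq_trans _ LM)// nL addKn -muln2 [(M * 2)%N]mulnC mulnA leq_mul2r.
    by apply/orP; right; clear; lia.
  have k2L' : (k2 <= L)%N.
    rewrite (leq_trans _ LM)// (@leq_trans (k1 + k2.+1 * 2))//; first by clear; lia.
    by rewrite leq_pmulr.
  have yLn : (1 - f) * y L <= y n by apply: yk => //; rewrite nL leq_addr.
  have ms : (M + s + s <= M.*2)%N by clear -s4; lia.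
  have := H1 M L M s k1M k1L ms.
  rewrite ler_distl => /andP[_ +].
  have B1 : s%:R ^+ 2 * q M (n - M)%N <= \sum_(i < s) \sum_(j < s) q (M + i + j).+2 L.
    apply: (block_ge (q^~ L)) => i /andP[i1 i2]; apply: q_homo => //.
    by rewrite subnKC// nL; clear -i2 s4; lia.
  have B2 : \sum_(i < s) \sum_(j < s) negbin (2 - b) (M + i + j).+2 <=
      s%:R ^+ 2 * ((1 + e / 4) * negbin (2 - b) M).
    apply: block_le => i /andP[i1 i2].
    apply: (@le_trans _ _ (negbin (2 - b) (M + 2 * s)%N)).
      by apply: negbin_le => //; clear -i2; lia.
    apply: le_trans (negbin_sublinear (2 - b) _ _ bpos b2' (leq_addr (2 * s) M)) _.
    rewrite ler_pM2r// -addSn natrD mulrDl divff ?pnatr_eq0// lerD2l natrM.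
    exact: sM2.
  move=> h.
  have yL0 := y_ge0 L.
  have := ler_wpM2l (ltW (rho_gt0 M)) B1; have := ler_wpM2l yL0 B2; have := err L.
  move=> h1 h2 h3; rewrite -(ler_pM2l Rs20).
  have h4 : rho M * (s%:R ^+ 2 * q M (n - M)%N) <= y L * (s%:R ^+ 2 * ((1 + e / 4) * negbin (2 - b) M)) +
      s%:R ^+ 2 * (e / 4 * (y L * negbin (2 - b) M)).
    apply: (le_trans h3); apply: (le_trans h); exact: lerD.
  rewrite [leLHS]mulrCA; apply: (le_trans h4).
  rewrite [leLHS](_ : _ = s%:R ^+ 2 * ((1 + e / 2) * (y L * negbin (2 - b) M))); last by field.
  rewrite ler_pM2l// !mulrA ler_pM2r//.
  have fe : (1 + e / 2) <= (1 + e) * (1 - f).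
    rewrite [leRHS](_ : _ = 1 + e - e / 4); last by rewrite /f; field; rewrite gt_eqF// addr_gt0.
    lra.
  apply: (le_trans (ler_wpM2r yL0 fe)); rewrite -mulrA ler_pM2l//.
  by rewrite addr_gt0.
by rewrite ler_distl; apply/andP; split; move: lower upper; lra.
Qed.

End RenewalAsymptotics.

(** * Visits, wandering rates and the first-entrance decomposition *)

Section Visits.
Context {d : measure_display} {X : measurableType d} {R : realType}.
Variables (mu : {measure set X -> \bar R}) (T : X -> X) (Y : set X).
Hypothesis T_mp : measure_preserving mu T.
Hypothesis mY : measurable Y.
Hypothesis muY_fin : (mu Y < +oo)%E.

(** Its measure is the wandering rate. *)
Definition visited n : set X := \bigcup_(k < n) (iter k T @^-1` Y).

(** The times i and i+L are excluded and included, so that unvisited m (n-m) is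
    the event that the last visit up to time n occurs at time m or before. *)
Definition unvisited i L : set X :=
  [set x | forall k, (i < k)%N -> (k <= i + L)%N -> ~ Y (iter k T x)].

Let mT : measurable_fun setT T. Proof. by case: T_mp. Qed.

Lemma measurable_iter k : measurable_fun setT (iter k T).
Proof.
elim: k => [|k IH]; first exact: measurable_id.
by apply: (measurableT_comp mT IH).
Qed.

Lemma measurable_iter_preimage k A : measurable A -> measurable (iter k T @^-1` A).
Proof. by move=> mA; rewrite -[X in measurable X]setTI; exact: measurable_iter. Qed.

Lemma measure_iter_preimage k A : measurable A -> mu (iter k T @^-1` A) = mu A.
Proof.
move=> mA; elim: k => [//|k IH]; rewrite -IH.
have [_ mpT] := T_mp; rewrite -[RHS](mpT _ (measurable_iter_preimage k A mA)).
by congr (mu _); apply/seteqP; split => x /=; rewrite -iterSr.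
Qed.

Lemma visited0 : visited 0 = set0.
Proof. by rewrite /visited -subset0 => x [k]. Qed.

Lemma visitedS n : visited n.+1 = visited n `|` iter n T @^-1` Y.
Proof.
apply/seteqP; split => x.
  move=> [k /= kn Yk]; have [kn'|kn'] := ltnP k n; first by left; exists k.
  by right; have <- : k = n by apply/eqP; rewrite eqn_leq kn' -ltnS kn.
move=> [[k /= kn Yk]|Yn]; first by exists k => //=; exact: ltnW.
by exists n => /=.
Qed.

Lemma visited_subset m n : (m <= n)%N -> visited m `<=` visited n.
Proof. by move=> mn x [k /= km Yk]; exists k => //=; exact: leq_trans mn. Qed.

Lemma visitedSr n : visited n.+1 = Y `|` T @^-1` visited n.
Proof.
apply/seteqP; split => x.
  move=> [[|k] /= kn Yk]; first by left.
  by right; exists k => //=; rewrite -iterSr.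
move=> [Yx|[k /= kn Yk]]; first by exists 0%N.
by exists k.+1 => //=; rewrite -iterS iterSr.
Qed.

Lemma measurable_visited n : measurable (visited n).
Proof. by apply: bigcup_measurable => k _; exact: measurable_iter_preimage. Qed.

(** Each Y_n consists of the points that enter Y for the first time at time n,
    the time 0 included. *)
Lemma level_setE n : level_set T Y n = (iter n T @^-1` Y) `\` visited n.
Proof.
case: n => [|n]; first by rewrite visited0 setD0.
rewrite /level_set; apply/seteqP; split => x.
  rewrite /first_return/= => -[nYx]; case: pselect => // ex [].
  case: ex_minnP => m /andP[m0 /asboolP Ym] mmin mn.
  rewrite mn in Ym mmin; split => // -[[|k] /= kn Yk]//.
  by have := mmin k.+1; rewrite asboolT//= => /(_ isT); rewrite leqNgt kn.
move=> [Yn nV]; split.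
  by move=> Yx; apply: nV; exists 0%N.
rewrite /first_return/=; case: pselect => [ex|[]]; last first.
  by exists n.+1; exact/asboolP.
congr Some; case: ex_minnP => m /andP[m0 /asboolP Ym] mmin.
apply/eqP; rewrite eqn_leq mmin ?asboolT//= ltnNge; apply/negP => mn.
by apply: nV; exists m.
Qed.

Lemma measurable_level_set n : measurable (level_set T Y n).
Proof.
rewrite level_setE; apply: measurableD; last exact: measurable_visited.
exact: measurable_iter_preimage.
Qed.

Lemma visited_level_set n : visited n.+1 = visited n `|` level_set T Y n.
Proof. by rewrite level_setE visitedS setUDr setDv setD0. Qed.

Lemma level_set_sub n : level_set T Y n `<=` iter n T @^-1` Y.
Proof. by rewrite level_setE => x []. Qed.

Lemma visited_fin n : (mu (visited n) < +oo)%E.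
Proof.
elim: n => [|n IH]; first by rewrite visited0 measure0.
rewrite visitedS.
apply: (@le_lt_trans _ _ (mu (visited n) + mu (iter n T @^-1` Y))%E).
  by apply: measureU2; [exact: measurable_visited|exact: measurable_iter_preimage].
by rewrite measure_iter_preimage// lte_add_pinfty.
Qed.

Lemma fin_num_sub_visited A n : measurable A -> A `<=` visited n -> mu A \is a fin_num.
Proof.
move=> mA AV; rewrite ge0_fin_numE//; apply: le_lt_trans (visited_fin n).
by apply: le_measure; rewrite ?inE//; exact: measurable_visited.
Qed.

Local Notation w := (wandering_rate mu T Y).

Lemma wandering_rateE n : (w n)%:E = mu (visited n).
Proof. by rewrite /wandering_rate fineK// (fin_num_sub_visited _ n)//; exact: measurable_visited. Qed.

Lemma wandering_rate_ge0 n : 0 <= w n.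
Proof. by rewrite fine_ge0. Qed.

Lemma wandering_rate_nd : nondecreasing_seq w.
Proof.
move=> m n mn; rewrite -lee_fin !wandering_rateE; apply: le_measure.
- by rewrite inE; exact: measurable_visited.
- by rewrite inE; exact: measurable_visited.
- exact: visited_subset.
Qed.

(** Measure preservation applied to the first step: the points that visit Y
    before time n+1 are those of Y and those whose image visits Y before time n. *)
Lemma wandering_rateS n : (w n.+1 - w n)%:E = mu (Y `\` T @^-1` visited n).
Proof.
have [_ mpT] := T_mp.
rewrite EFinB !wandering_rateE visitedSr -[X in (_ - X)%E]mpT; last exact: measurable_visited.
have mTV : measurable (T @^-1` visited n).
  by rewrite -[X in measurable X]setTI; apply: mT => //; exact: measurable_visited.
have -> : Y `|` T @^-1` visited n = T @^-1` visited n `|` (Y `\` T @^-1` visited n).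
  by rewrite setUDr setDv setD0 setUC.
rewrite measureU//; last 2 first.
- exact: measurableD.
- by rewrite setDIK.
rewrite [X in (X - _)%E]addeC addeK//.
have mV := measurable_visited n.
change (mu (T @^-1` visited n) \is a fin_num).
by rewrite (mpT _ mV) (fin_num_sub_visited _ n).
Qed.

Lemma wandering_rate_concave m n : (m <= n)%N -> w n.+1 - w n <= w m.+1 - w m.
Proof.
move=> mn; rewrite -lee_fin !wandering_rateS.
have mTV k : measurable (Y `\` T @^-1` visited k).
  apply: measurableD => //.
  by rewrite -[X in measurable X]setTI; apply: mT => //; exact: measurable_visited.
apply: le_measure; rewrite ?inE//.
by apply: setDS => x /=; exact: visited_subset.
Qed.

Lemma wandering_rate1 : (w 1)%:E = mu Y.
Proof. by rewrite wandering_rateE visitedS visited0 set0U. Qed.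

Lemma measurable_unvisited i L : measurable (unvisited i L).
Proof.
rewrite (_ : unvisited i L = ~` (\bigcup_(k in [set k | (i < k <= i + L)%N])
    (iter k T @^-1` Y))).
  by apply: measurableC; apply: bigcup_measurable => k _; exact: measurable_iter_preimage.
apply/seteqP; split => x /=.
  by move=> xi [k /= /andP[ik kL]]; exact: xi.
by move=> xi k ik kL Yk; apply: xi; exists k => //=; rewrite ik.
Qed.

Lemma iter_unvisited k i L : iter k T @^-1` unvisited i L = unvisited (i + k) L.
Proof.
apply/seteqP; split => x /= xi j ij jL.
  have kj : (k <= j)%N by rewrite (leq_trans _ ij)// leqW// leq_addl.
  by rewrite -(subnK kj) iterD; apply: xi; clear -ij jL kj; lia.
by rewrite -iterD; apply: xi; clear -ij jL; lia.
Qed.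

Lemma unvisited_homo i i' L L' : (i <= i')%N -> (i' + L' <= i + L)%N ->
  unvisited i L `<=` unvisited i' L'.
Proof.
by move=> ii' LL' x xi k ik kL; apply: xi; [exact: leq_ltn_trans ik|exact: leq_trans LL'].
Qed.

(** The integral over E of the sum over k < n of the transferred indicators of
    the level sets. *)
Definition level_mass n (E : set X) : R :=
  \sum_(k < n) fine (mu (level_set T Y k `&` iter k T @^-1` E)).

Lemma level_set_fin n A : measurable A -> mu (level_set T Y n `&` A) \is a fin_num.
Proof.
move=> mA; apply: (fin_num_sub_visited _ n.+1).
  by apply: measurableI => //; exact: measurable_level_set.
by rewrite visited_level_set => x [Yx _]; right.
Qed.

Lemma level_massE n E : measurable E -> (level_mass n E)%:E =
  (\sum_(k < n) mu (level_set T Y k `&` iter k T @^-1` E))%E.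
Proof.
move=> mE; rewrite /level_mass -sumEFin; apply: eq_bigr => k _.
by rewrite fineK// level_set_fin//; exact: measurable_iter_preimage.
Qed.

Lemma level_mass_nd E m n : (m <= n)%N -> level_mass m E <= level_mass n E.
Proof.
by move=> /subnKC <-; rewrite /level_mass big_split_ord/= lerDl sumr_ge0.
Qed.

Lemma mass_fin E : measurable E -> mu (Y `&` E) \is a fin_num.
Proof.
move=> mE; rewrite (fin_num_sub_visited _ 1)//; first exact: measurableI.
by rewrite visitedS visited0 set0U => x [].
Qed.

Lemma level_mass_le n E : measurable E -> level_mass n E <= n%:R * fine (mu (Y `&` E)).
Proof.
move=> mE; apply: (sum_le_cst (fun k => fine (mu (level_set T Y k `&` iter k T @^-1` E)))) => k _.
have mTE := measurable_iter_preimage k E mE.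
rewrite fine_le ?level_set_fin ?mass_fin//.
rewrite -(measure_iter_preimage k (Y `&` E)); last exact: measurableI.
apply: le_measure; rewrite ?inE.
- by apply: measurableI => //; exact: measurable_level_set.
- by apply: measurable_iter_preimage; exact: measurableI.
by rewrite preimage_setI; apply: setSI; exact: level_set_sub.
Qed.

(** Both sides are the measure of the set of points that visit Y during [0,m]
    but not during [m+1,m+L]: the left-hand side splits this set by the first
    entrance time, and the right-hand side is the measure of the points visiting
    Y during [0,m+L] minus that of the points visiting it during [m+1,m+L]. *)
Lemma level_mass_renewal m L :
  \sum_(j < m.+1) (level_mass j.+1 (unvisited (m - j) L) - level_mass j (unvisited (m - j) L))
  = w (m + L).+1 - w L.
Proof.
have mU := measurable_unvisited m L.
have mpI A : measurable A -> measurable (A `&` unvisited m L) by move=> ?; exact: measurableI.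
have step n : (n <= m.+1)%N ->
  \sum_(j < n) (level_mass j.+1 (unvisited (m - j) L) - level_mass j (unvisited (m - j) L))
    = fine (mu (visited n `&` unvisited m L)).
  elim: n => [_|n IH nm].
    by rewrite big_ord0 visited0 set0I measure0.
  rewrite big_ord_recr/= IH ?(ltnW nm)// /level_mass big_ord_recr/= addrAC subrr add0r.
  rewrite iter_unvisited subnK; last by rewrite -ltnS.
  have mL := measurable_level_set n; have mV := measurable_visited n.
  rewrite visited_level_set setIUl measureU; [|exact: mpI|exact: mpI|].
    rewrite fineD//; last exact: level_set_fin.
    by apply: (fin_num_sub_visited _ n); [exact: mpI|exact: subIsetl].
  by rewrite level_setE; apply/seteqP; split => // x [[Vx _] [[_ nV] _]]; exact: nV.
rewrite step//; apply/EFin_inj; rewrite fineK; last first.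
  by apply: (fin_num_sub_visited _ m.+1); [exact/mpI/measurable_visited|exact: subIsetl].
(* the points that visit Y during [m+1,m+L] *)
pose B := iter m.+1 T @^-1` visited L.
have mB : measurable B by apply: measurable_iter_preimage; exact: measurable_visited.
have UB : visited (m + L).+1 = B `|` (visited m.+1 `&` unvisited m L).
  apply/seteqP; split => x.
    move=> [k /= kmL Yk]; have [xB|xB] := pselect (B x); [by left|right].
    split; last first.
      move=> j mj jmL Yj; apply: xB; exists (j - m.+1)%N => /=; first by lia.
      by rewrite -[T (iter m T x)]/(iter m.+1 T x) -iterD subnK.
    exists k => //=; rewrite ltnNge; apply/negP => mk; apply: xB.
    exists (k - m.+1)%N => /=; first by lia.
    by rewrite -[T (iter m T x)]/(iter m.+1 T x) -iterD subnK.
  move=> [[k /= kL]|[[k /= km Yk] _]].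
    by rewrite -[T (iter m T x)]/(iter m.+1 T x) -iterD => Yk; exists (k + m.+1)%N => //=; lia.
  by exists k => //=; rewrite (leq_trans km)// ltnS leq_addr.
have muB : mu B = mu (visited L).
  by apply: measure_iter_preimage; exact: measurable_visited.
have BU : B `&` (visited m.+1 `&` unvisited m L) = set0.
  apply/seteqP; split => // x [[k /= kL]].
  rewrite -[T (iter m T x)]/(iter m.+1 T x) -iterD => Yk [_ xi].
  by case: (xi (k + m.+1)%N) => //; lia.
have mVU : measurable (visited m.+1 `&` unvisited m L).
  by apply: mpI; exact: measurable_visited.
have muU : mu (B `|` (visited m.+1 `&` unvisited m L)) =
    (mu B + mu (visited m.+1 `&` unvisited m L))%E by rewrite measureU.
rewrite EFinB !wandering_rateE UB muU muB [X in (X - _)%E]addeC addeK//.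
by apply: (fin_num_sub_visited _ L) => //; exact: measurable_visited.
Qed.

End Visits.

(** * Integration of the transfer operator hypotheses *)

Section Transfer.
Context {d : measure_display} {X : measurableType d} {R : realType}.
Variables (mu : {measure set X -> \bar R}) (T : X -> X) (Y : set X).
Variables (That : (X -> \bar R) -> X -> \bar R) (H : X -> R).
Hypothesis T_mp : measure_preserving mu T.
Hypothesis mY : measurable Y.
Hypothesis muY_gt0 : (0 < mu Y)%E.
Hypothesis muY_fin : (mu Y < +oo)%E.
Hypothesis That_transfer : transfer_operator mu T That.

Local Notation w := (wandering_rate mu T Y).
Local Notation avg := (transfer_average mu T That Y).
Local Notation f := (fun k => iter k That (EFin \o \1_(level_set T Y k))).

Lemma wandering_rate_gt0 n : 0 < w n.+1.
Proof.
apply: (@lt_le_trans _ _ (w 1)).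
  by rewrite -lte_fin (wandering_rate1 _ _ _ T_mp mY muY_fin).
exact: (wandering_rate_nd _ _ _ T_mp mY muY_fin).
Qed.

Lemma iter_transfer (u : X -> \bar R) k :
  measurable_fun setT u -> (forall x, 0 <= u x)%E ->
  [/\ measurable_fun setT (iter k That u), (forall x, 0 <= iter k That u x)%E &
   forall v : X -> \bar R, measurable_fun setT v -> (forall x, 0 <= v x)%E ->
   (\int[mu]_x (v (iter k T x) * u x) = \int[mu]_x (v x * iter k That u x))%E].
Proof.
move=> mu0 u0; have [_ tr] := That_transfer; have [mT _] := T_mp.
elim: k => [|k [mk k0 kE]]; first by split.
have [mk' k0' kE'] := tr _ mk k0; split => // v mv v0.
have mvT : measurable_fun setT (v \o T) by exact: measurableT_comp mv mT.
have vT0 x : (0 <= (v \o T) x)%E by exact: v0.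
by rewrite -kE'// -(kE _ mvT vT0).
Qed.

(** The duality of the transfer operator with the indicator of E as a test
    function. *)
Lemma integral_iter_transfer (u : X -> \bar R) k E : measurable E ->
  measurable_fun setT u -> (forall x, 0 <= u x)%E ->
  (\int[mu]_(x in E) iter k That u x = \int[mu]_(x in iter k T @^-1` E) u x)%E.
Proof.
move=> mE mu0 u0; have [mk k0 kE] := iter_transfer u k mu0 u0.
rewrite integral_mkcond epatch_indic [RHS]integral_mkcond epatch_indic.
have mI : measurable_fun setT (EFin \o \1_E : X -> \bar R).
  exact/measurable_EFinP/measurable_indic.
have I0 x : (0 <= (EFin \o \1_E) x :> \bar R)%E by rewrite lee_fin.
transitivity (\int[mu]_x ((EFin \o \1_E) x * iter k That u x))%E.
  by apply: eq_integral => x _; rewrite muleC.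
by rewrite -(kE _ mI I0); apply: eq_integral => x _; rewrite muleC.
Qed.

Let mL k : measurable (level_set T Y k).
Proof. exact: (measurable_level_set _ _ _ T_mp mY). Qed.

Let m1L k : measurable_fun setT (EFin \o \1_(level_set T Y k) : X -> \bar R).
Proof. exact/measurable_EFinP/measurable_indic. Qed.

Let L0 k x : (0 <= (EFin \o \1_(level_set T Y k)) x :> \bar R)%E.
Proof. by rewrite lee_fin. Qed.

Let mf k : measurable_fun setT (f k).
Proof. by have [] := iter_transfer _ k (m1L k) (L0 k). Qed.

Let f0 k x : (0 <= f k x)%E.
Proof. by have [_ + _] := iter_transfer _ k (m1L k) (L0 k); exact. Qed.

Lemma integral_transferred_level k E : measurable E ->
  (\int[mu]_(x in E) f k x)%E = mu (level_set T Y k `&` iter k T @^-1` E).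
Proof.
move=> mE; rewrite (integral_iter_transfer _ k E mE (m1L k) (L0 k)).
by rewrite integral_indic//; exact: (measurable_iter_preimage _ _ T_mp).
Qed.

Lemma measurable_transfer_average n : measurable_fun setT (avg n).
Proof.
apply: measurable_funeM; apply: emeasurable_sum => k; exact: mf.
Qed.

Lemma transfer_average_ge0 n x : (0 <= avg n x)%E.
Proof.
rewrite mule_ge0 ?sume_ge0// lee_fin invr_ge0.
exact: wandering_rate_ge0.
Qed.

Lemma integral_transfer_average n E : measurable E ->
  (\int[mu]_(x in E) avg n x)%E = ((w n)^-1 * level_mass mu T Y n E)%:E.
Proof.
move=> mE; rewrite /transfer_average ge0_integralZl//=.
- rewrite EFinM (level_massE _ _ _ T_mp mY muY_fin)// ge0_integral_sum//.
  + by congr (_ * _)%E; apply: eq_bigr => k _; exact: integral_transferred_level.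
  + by move=> k; apply: measurable_funTS; exact: mf.
- by apply: measurable_funTS; apply: emeasurable_sum => k; exact: mf.
- by move=> x _; apply: sume_ge0 => k _; exact: f0.
- by rewrite lee_fin invr_ge0 wandering_rate_ge0.
Qed.

(** The k-th iterate of T maps the k-th level set into Y. *)
Lemma transferred_level_support : {ae mu, forall x, ~ Y x -> forall k, f k x = 0%E}.
Proof.
have : {ae mu, forall x, forall k, ~ Y x -> f k x = 0%E}.
  apply: ae_foralln => k.
  have mYC : measurable (~` Y) by exact: measurableC.
  apply: (ae_eq_integral_abs mu mYC (f := f k) _).1.
    by apply: measurable_funTS; exact: mf.
  rewrite (eq_integral (f k)); last by move=> x _; rewrite gee0_abs// f0.
  rewrite integral_transferred_level//.
  rewrite (_ : _ `&` _ = set0) ?measure0//.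
  by apply/seteqP; split => // x [/level_set_sub Yx nY]; exact: nY.
by apply: filterS => x Hx nY k; exact: Hx.
Qed.

(** The sweeping inequality integrated over E. *)
Lemma uniform_sweeping_mass :
  (exists2 N : nat, (0 < N)%N & uniformly_sweeping mu That
     [set avg n | n in [set n | (N <= n)%N]] (EFin \o \1_Y)) ->
  exists C K N, 0 < C /\ forall n, (N <= n)%N -> forall E, measurable E ->
    w n * fine (mu (Y `&` E)) <=
      C * \sum_(k < K.+1) level_mass mu T Y n (iter k T @^-1` E).
Proof.
move=> [N N0 [C C0 [K sw]]]; exists C, K, N; split => // n Nn E mE.
have wn : 0 < w n by rewrite -(prednK (leq_trans N0 Nn)) wandering_rate_gt0.
have mavg := measurable_transfer_average n.
have avg0 := transfer_average_ge0 n.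
have it k := iter_transfer _ k mavg avg0.
have ae1 := sw (avg n) (ex_intro2 _ _ n Nn erefl).
have : (\int[mu]_(x in E) (EFin \o \1_Y) x <=
    \int[mu]_(x in E) (C%:E * \sum_(k < K.+1) iter k That (avg n) x))%E.
  apply: ae_ge0_le_integral => //.
  - by move=> x _; rewrite lee_fin.
  - by apply: measurable_funTS; exact/measurable_EFinP/measurable_indic.
  - move=> x _; apply: mule_ge0; first by rewrite lee_fin ltW.
    by apply: sume_ge0 => k _; have [_ + _] := it k; exact.
  - apply: measurable_funTS; apply: measurable_funeM; apply: emeasurable_sum => k.
    by have [] := it k.
  - by apply: filterS ae1 => x + _; exact.
rewrite integral_indic// ge0_integralZl//; last 3 first.
- by apply: measurable_funTS; apply: emeasurable_sum => k; have [] := it k.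
- by move=> x _; apply: sume_ge0 => k _; have [_ + _] := it k; exact.
- by rewrite lee_fin ltW.
rewrite ge0_integral_sum//; last 2 first.
- by move=> k; apply: measurable_funTS; have [] := it k.
- by move=> k x _; have [_ + _] := it k; exact.
rewrite (eq_bigr (fun k : 'I_K.+1 =>
    ((w n)^-1 * level_mass mu T Y n (iter k T @^-1` E))%:E)); last first.
  move=> k _; rewrite integral_iter_transfer// integral_transfer_average//.
  exact: (measurable_iter_preimage _ _ T_mp).
rewrite sumEFin -EFinM -[X in (X <= _)%E]fineK; last exact: (mass_fin _ _ _ T_mp mY muY_fin).
rewrite lee_fin -mulr_sumr => h.
rewrite mulrC -ler_pdivlMr//; apply: (le_trans h).
by rewrite mulrCA mulrC.
Qed.

Hypothesis mH : measurable_fun setT H.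
Hypothesis average_cvg :
  ('N[mu]_+oo [(fun x => avg n x - (H x)%:E)])%E @[n --> \oo] --> 0%E.

Lemma average_close_ae (e : R) : 0 < e -> \forall n \near \oo,
  {ae mu, forall x, (`|avg n x - (H x)%:E| <= e%:E)%E}.
Proof.
move=> e0; have muT : (0 < mu [set: X])%E.
  by apply: lt_le_trans muY_gt0 _; apply: le_measure; rewrite ?inE.
have : \forall n \near \oo, ('N[mu]_+oo [(fun x => avg n x - (H x)%:E)] < e%:E)%E.
  have nbhs0 : nbhs (0%E : \bar R) [set u | (u < e%:E)%E].
    by apply: open_ereal_lt'; rewrite lte_fin.
  exact: (average_cvg _ nbhs0).
apply: filterS => n; rewrite unlock muT => ne.
have := ess_sup_ge mu (abse \o (fun x => avg n x - (H x)%:E)%E).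
by apply: filterS => x /le_trans; apply; exact: ltW.
Qed.

(** A version of H that is nonnegative and supported in Y everywhere, which
    makes the integration theory of nonnegative functions available. *)
Let g x : R := Num.max 0 (H x) * \1_Y x.

Let mg : measurable_fun setT g.
Proof.
apply: measurable_funM; last exact: measurable_indic.
by apply: measurable_maxr => //; exact: measurable_cst.
Qed.

Let g_ge0 x : 0 <= g x.
Proof. by rewrite mulr_ge0// le_max lexx. Qed.

Let dist_fin (a : \bar R) (h e : R) : (`|a - h%:E| <= e%:E)%E ->
  exists2 r, a = r%:E & `|r - h| <= e.
Proof. by case: a => [r| |]//= re; exists r. Qed.

(** The averages are nonnegative and almost everywhere 0 off Y, and these
    properties pass to their limit. *)
Lemma limit_density : {ae mu, forall x, H x = g x}.
Proof.
have : {ae mu, forall x, forall j : nat, exists n,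
    (`|avg n x - (H x)%:E| <= j.+1%:R^-1%:E)%E}.
  apply: ae_foralln => j.
  have j0 : 0 < j.+1%:R^-1 :> R by rewrite invr_gt0.
  have [N _ /(_ N (leqnn N))] := average_close_ae _ j0.
  by apply: filterS => x hx; exists N.
apply: filterS2 transferred_level_support => x supp close.
have H_ge0 : 0 <= H x.
  rewrite leNgt; apply/negP => Hx0.
  have [n] := close (Num.trunc (- (H x))^-1).
  move=> /dist_fin[r re]; rewrite ler_distl => /andP[_ rH].
  have := transfer_average_ge0 n x; rewrite re lee_fin => r0.
  have : (Num.trunc (- H x)^-1).+1%:R^-1 < - H x.
    rewrite -[ltRHS]invrK ltf_pV2 ?posrE// ?invr_gt0 ?oppr_gt0//.
    exact: truncnS_gt.
  move=> h; have : H x + (Num.trunc (- H x)^-1).+1%:R^-1 < 0 by rewrite -ltrBrDl sub0r.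
  by rewrite ltNge (le_trans r0).
rewrite /g indicE; case: (boolP (x \in Y)) => [_|]; first by rewrite mulr1 max_r.
rewrite notin_setE mulr0 => nY; apply/eqP; rewrite eq_le H_ge0 andbT leNgt; apply/negP => Hx0.
have [n] := close (Num.trunc (H x)^-1).
have -> : avg n x = 0%E.
  by rewrite /transfer_average big1 ?mule0// => k _; exact: supp.
rewrite sub0e abseN lee_fin gtr0_norm// leNgt => /negP; apply.
rewrite -[ltRHS]invrK ltf_pV2 ?posrE// ?invr_gt0//; exact: truncnS_gt.
Qed.

Lemma integral_limit_density E : measurable E ->
  (\int[mu]_(x in E) (H x)%:E = \int[mu]_(x in E) (g x)%:E)%E.
Proof.
move=> mE; apply: ae_eq_integral => //.
- by apply: measurable_funTS; exact/measurable_EFinP.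
- by apply: measurable_funTS; exact/measurable_EFinP.
- by apply: filterS limit_density => x -> _.
Qed.

Let integralD_indic (u : X -> \bar R) (e : R) E : 0 <= e -> measurable E ->
  measurable_fun setT u -> (forall x, 0 <= u x)%E ->
  (\int[mu]_(x in E) (u x + (e * \1_Y x)%:E) =
   \int[mu]_(x in E) u x + (e * fine (mu (Y `&` E)))%:E)%E.
Proof.
move=> e0 mE mu0 u0; rewrite ge0_integralD//.
- congr (_ + _)%E; under eq_integral do rewrite EFinM.
  rewrite ge0_integralZl//.
    by rewrite integral_indic// EFinM fineK//; exact: (mass_fin _ _ _ T_mp mY muY_fin).
  by apply: measurable_funTS; exact/measurable_EFinP/measurable_indic.
- exact: measurable_funTS.
- by move=> x _; rewrite lee_fin mulr_ge0.
- apply: measurable_funTS; apply/measurable_EFinP.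
  by apply: measurable_funM => //; exact: measurable_indic.
Qed.

(** Off Y both the averages and H vanish almost everywhere, so the uniform error
    is only integrated over Y, which has finite measure. *)
Lemma average_close_integral (e : R) : 0 < e -> \forall n \near \oo,
  forall E, measurable E ->
  (\int[mu]_(x in E) avg n x <= \int[mu]_(x in E) (H x)%:E + (e * fine (mu (Y `&` E)))%:E)%E /\
  (\int[mu]_(x in E) (H x)%:E <= \int[mu]_(x in E) avg n x + (e * fine (mu (Y `&` E)))%:E)%E.
Proof.
move=> e0; apply: filterS (average_close_ae _ e0) => n close E mE.
have mavg := measurable_transfer_average n.
have avg0 := transfer_average_ge0 n.
have eg0 : forall x, (0 <= (g x)%:E)%E by move=> x; rewrite lee_fin.
have mEg : measurable_fun setT (EFin \o g) by exact/measurable_EFinP.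
have mI : measurable_fun setT (fun x => (e * \1_Y x)%:E).
  by apply/measurable_EFinP; apply: measurable_funM => //; exact: measurable_indic.
have eI0 x : (0 <= (e * \1_Y x)%:E)%E by rewrite lee_fin mulr_ge0// ltW.
have ptw : {ae mu, forall x, (avg n x <= (g x)%:E + (e * \1_Y x)%:E)%E /\
    ((g x)%:E <= avg n x + (e * \1_Y x)%:E)%E}.
  have := transferred_level_support; apply: filterS3 limit_density close => x Hg cl supp.
  case: (boolP (x \in Y)) => [xY|].
    have -> : \1_Y x = 1 :> R by rewrite indicE xY.
    move: cl; rewrite Hg => /dist_fin[r ->]; rewrite mulr1 ler_distl => /andP[r1 r2].
    by rewrite -!EFinD !lee_fin r2 -lerBlDr.
  rewrite notin_setE => nY.
  have -> : avg n x = 0%E by rewrite /transfer_average big1 ?mule0// => k _; exact: supp.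
  have -> : g x = 0 by rewrite /g indicE memNset ?mulr0.
  by rewrite !add0e eI0.
rewrite integral_limit_density//.
have /= <- := integralD_indic (EFin \o g) e E (ltW e0) mE mEg eg0.
have <- := integralD_indic (avg n) e E (ltW e0) mE mavg avg0.
split; apply: ae_ge0_le_integral => //.
- exact: measurable_funTS.
- by move=> x _; rewrite adde_ge0.
- by apply: measurable_funTS; exact: emeasurable_funD.
- by apply: filterS ptw => x [+ _] _.
- exact: measurable_funTS.
- by move=> x _; rewrite adde_ge0.
- by apply: measurable_funTS; exact: emeasurable_funD.
- by apply: filterS ptw => x [_ +] _.
Qed.

Lemma limit_mass_fin E : measurable E -> (\int[mu]_(x in E) (H x)%:E)%E \is a fin_num.
Proof.
move=> mE; rewrite ge0_fin_numE; last first.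
  by rewrite integral_limit_density// integral_ge0// => x _; rewrite lee_fin.
have [N _ /(_ N (leqnn N) E mE)[_]] := average_close_integral 1 ltr01.
move/le_lt_trans; apply; rewrite integral_transfer_average// -EFinD.
exact: ltry.
Qed.

Lemma limit_mass_ge0 E : measurable E -> 0 <= fine (\int[mu]_(x in E) (H x)%:E)%E.
Proof.
move=> mE; apply: fine_ge0; rewrite integral_limit_density// integral_ge0// => x _.
by rewrite lee_fin.
Qed.

Lemma limit_mass_le E F : measurable E -> measurable F -> E `<=` F ->
  fine (\int[mu]_(x in E) (H x)%:E)%E <= fine (\int[mu]_(x in F) (H x)%:E)%E.
Proof.
move=> mE mF EF; rewrite fine_le ?limit_mass_fin//.
rewrite !integral_limit_density//; apply: ge0_subset_integral => //.
- by apply: measurable_funTS; exact/measurable_EFinP.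
- by move=> x _; rewrite lee_fin.
Qed.

Lemma level_mass_close (e : R) : 0 < e -> exists n0, forall n, (n0 <= n)%N ->
  forall E, measurable E ->
  `|level_mass mu T Y n E - w n * fine (\int[mu]_(x in E) (H x)%:E)%E|
    <= e * w n * fine (mu (Y `&` E)).
Proof.
move=> e0; have [N _ NP] := average_close_integral _ e0; exists N.+1 => n Nn E mE.
have [] := NP n (ltnW Nn) E mE; rewrite integral_transfer_average//.
rewrite -[(\int[mu]_(x in E) (H x)%:E)%E]fineK ?limit_mass_fin//.
set h := fine _; set m := fine (mu _); set s := level_mass _ _ _ _ _.
have wn : 0 < w n by rewrite -(prednK (leq_ltn_trans (leq0n N) Nn)) wandering_rate_gt0.
rewrite -!EFinD !lee_fin mulrC ler_pdivrMr// -lerBlDr ler_pdivlMr// => h1 h2.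
by rewrite ler_distl/=; apply/andP; split; lra.
Qed.

End Transfer.

(** * Limits of sequences and the last visit event *)

Section Assembly.
Context {R : realType}.

(** For 0 < a < 1, x^a lies between 1 and x. *)
Lemma powR_dist1 (a x : R) : 0 < a -> a < 1 -> 0 < x -> `|x `^ a - 1| <= `|x - 1|.
Proof.
move=> a0 a1 x0; have [x1|x1] := leP 1 x.
  have h1 : 1 <= x `^ a by rewrite -(powRr0 x) ler_powR// ltW.
  have h2 : x `^ a <= x by rewrite ler1_powR// ltW.
  by rewrite !ger0_norm ?subr_ge0// lerD2r.
have h1 : x `^ a <= 1 by rewrite -(powRr0 x) ger_powR// ?x0 ltW.
have h2 : x <= x `^ a by rewrite ger1_powR// ?x0 ltW.
by rewrite !ler0_norm ?subr_le0 ?(ltW x1)// lerN2 lerD2r.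
Qed.

Lemma powR_cvg1 (a : R) (u : nat -> R) : 0 < a -> a < 1 -> (forall n, 0 < u n) ->
  u n @[n --> \oo] --> (1 : R) -> u n `^ a @[n --> \oo] --> (1 : R).
Proof.
move=> a0 a1 u0 u1; apply/cvgrPdist_le => e e0.
have /cvgrPdist_le/(_ _ e0) := u1; apply: filterS => n; rewrite distrC => h.
by rewrite distrC (le_trans (powR_dist1 _ _ a0 a1 (u0 n))).
Qed.

Lemma slowly_varying_ratio (l : R -> R) (u v : nat -> R) : slowly_varying l ->
  v n @[n --> \oo] --> +oo ->
  (\forall n \near \oo, v n / 2 <= u n <= 2 * v n) ->
  l (u n) / l (v n) @[n --> \oo] --> (1 : R).
Proof.
move=> lsv vy uv; apply/cvgrPdist_le => e e0.
have l2 : 1 < 2 :> R by rewrite ltr1n.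
have v0 : \forall n \near \oo, 0 < v n.
  by have /cvgryPgt/(_ 0) := vy.
have := vy _ (slowly_varying_uniform l lsv 2 e l2 e0).
move: uv v0; apply: filterS3 => n /andP[u1 u2] v0 h.
rewrite distrC ltW//; have := h (u n / v n); rewrite divfK ?gt_eqF//; apply.
by rewrite ler_pdivlMr// ler_pdivrMr// mulrC u1.
Qed.

Lemma natr_shift_cvg1 (a c : R) : 0 < a ->
  (n%:R + c) / (n%:R + a) @[n --> \oo] --> (1 : R).
Proof.
move=> a0.
have h : (c - a) / (n%:R + a) @[n --> \oo] --> (0 : R).
  rewrite -[X in _ --> X](mulr0 (c - a)); apply: cvgM; first exact: cvg_cst.
  apply/gtr0_cvgV0; first by apply: nearW => n; rewrite ltr_wpDl.
  apply: (@ger_cvgy _ _ _ _ (fun n => n%:R)); last exact: cvgr_idn.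
  by apply: nearW => n; rewrite lerDl ltW.
have : 1 + (c - a) / (n%:R + a) @[n --> \oo] --> (1 : R).
  by rewrite -[X in _ --> X]addr0; apply: cvgD => //; exact: cvg_cst.
apply: cvg_trans; apply: near_eq_cvg; apply: nearW => n.
have : n%:R + a != 0 by rewrite gt_eqF// ltr_wpDl.
by move=> na; field.
Qed.

Lemma truncn_cvgy (u : nat -> R) : u n @[n --> \oo] --> +oo ->
  Num.trunc (u n) @[n --> \oo] --> \oo.
Proof.
move=> uy A [N _ NA].
have /cvgryPge/(_ N%:R) := uy; apply: filterS => n Nu.
apply: NA => /=; rewrite -ltnS -(ltr_nat R).
exact: le_lt_trans (truncnS_gt _).
Qed.

Lemma cvg_near_eq (f g : nat -> R) (z : R) :
  f @ \oo --> z -> (\forall n \near \oo, g n = f n) -> g @ \oo --> z.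
Proof.
move=> fz fg; apply: cvg_trans fz; apply: near_eq_cvg.
by apply: filterS fg => n ->.
Qed.

End Assembly.

Section LastVisit.
Context {d : measure_display} {X : measurableType d} {R : realType}.
Variables (T : X -> X) (Y : set X).

Lemma last_visit_le n m x : (m <= n)%N ->
  (last_visit T Y n x <= m)%N <-> unvisited T Y m (n - m) x.
Proof.
move=> mn; split.
  move=> /bigmax_leqP h k mk; rewrite subnKC// => kn Yk.
  have kn' : (k < n.+1)%N by rewrite ltnS.
  by have := h (Ordinal kn'); rewrite asboolT// leqNgt mk => /(_ isT).
move=> h; apply/bigmax_leqP => k /asboolP Yk; rewrite leqNgt; apply/negP => mk.
by apply: (h k mk) => //; rewrite subnKC// -ltnS.
Qed.

Lemma last_visit_fraction_le n (c : R) : (0 < n)%N -> 0 <= c <= 1 ->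
  [set x | (last_visit T Y n x)%:R / n%:R <= c] =
  unvisited T Y (Num.trunc (c * n%:R)) (n - Num.trunc (c * n%:R)).
Proof.
move=> n0 /andP[c0 c1].
have mn : (Num.trunc (c * n%:R) <= n)%N.
  have h : (Num.trunc (c * n%:R))%:R <= c * n%:R by rewrite truncn_le mulr_ge0.
  by rewrite -(ler_nat R) (le_trans h)// ler_piMl.
apply/seteqP; split => x /=; rewrite ler_pdivrMr ?ltr0n// -truncn_ge_nat ?mulr_ge0//.
  by move=> /(last_visit_le _ _ _ mn).
by move=> h; apply/(last_visit_le _ _ _ mn).
Qed.

End LastVisit.

(** * Asymptotics of the last visit *)

(** The dynamical input of renewal_asymptotics: sigma, q and qY are the masses
    that the level sets, H and Y give to the avoidance events. *)
Lemma last_visit_asymptotics (R : realType) (d : measure_display) (X : measurableType d)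
    (mu : {measure set X -> \bar R}) (T : X -> X)
    (That : (X -> \bar R) -> X -> \bar R) (Y : set X)
    (b : R) (H : X -> R) :
  measure_preserving mu T -> measurable Y -> (0 < mu Y)%E -> (mu Y < +oo)%E ->
  transfer_operator mu T That ->
  0 < b -> b < 1 ->
  (forall e : R, 0 < e -> \forall M \near \oo, forall j, (j <= M.*2)%N ->
    `|wandering_rate mu T Y j.+1 / wandering_rate mu T Y M.+1 -
      negbin (1 + b) j / negbin (1 + b) M| <= e) ->
  (exists2 N : nat, (0 < N)%N &
       uniformly_sweeping mu That
         [set transfer_average mu T That Y n | n in [set n | (N <= n)%N]]
         (EFin \o \1_Y)) ->
  measurable_fun setT H ->
  ('N[mu]_+oo [(fun x => transfer_average mu T That Y n x - (H x)%:E)])%E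
         @[n --> \oo] --> 0%E ->
  forall e : R, 0 < e -> exists k, forall M n, (k <= M)%N -> (k * M <= n)%N ->
    `|wandering_rate mu T Y M.+1 / negbin (1 + b) M *
        fine (mu_dens mu (EFin \o H) (unvisited T Y M (n - M))) -
      (wandering_rate mu T Y n.+1 - wandering_rate mu T Y n) * negbin (2 - b) M| <=
    e * ((wandering_rate mu T Y n.+1 - wandering_rate mu T Y n) * negbin (2 - b) M).
Proof.
move=> T_mp mY muY_gt0 muY_fin tr b0 b1 w_negbin sw mH avgH.
pose w := wandering_rate mu T Y.
have w_gt0 : forall n, 0 < w n.+1 by exact: wandering_rate_gt0.
have w_ge0 : forall n, 0 <= w n by exact: wandering_rate_ge0.
have w_nd : nondecreasing_seq w by exact: wandering_rate_nd.
have y_ge0 n : 0 <= w n.+1 - w n by rewrite subr_ge0 w_nd.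
have y_noninc : forall m n, (m <= n)%N -> w n.+1 - w n <= w m.+1 - w m.
  exact: wandering_rate_concave.
have w_cvgy : w n @[n --> \oo] --> +oo by exact: (concave_rate_cvgy w b).
have mU i L : measurable (unvisited T Y i L) by exact: (measurable_unvisited _ _ _ T_mp).
pose q i L := fine (\int[mu]_(x in unvisited T Y i L) (H x)%:E)%E.
pose qY i L := fine (mu (Y `&` unvisited T Y i L)).
pose sigma n i L := level_mass mu T Y n (unvisited T Y i L).
have close := level_mass_close mu T Y That H T_mp mY muY_gt0 muY_fin tr mH avgH.
apply: (renewal_asymptotics w b q) => //.
- by move=> i L; apply: (limit_mass_ge0 mu T Y That H T_mp mY muY_gt0 tr mH avgH).
- move=> i i' L L' ii' LL'.
  apply: (limit_mass_le mu T Y That H T_mp mY muY_gt0 muY_fin tr mH avgH) => //.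
  exact: unvisited_homo.
apply: (renewal_convolution w sigma q qY) => //.
- by move=> i L; rewrite /sigma /level_mass big_ord0.
- by move=> i L m n; exact: level_mass_nd.
- by move=> n i L; exact: level_mass_le.
- by move=> i L; apply: (limit_mass_ge0 mu T Y That H T_mp mY muY_gt0 tr mH avgH).
- by move=> i L; exact: fine_ge0.
- have [n0 cl] := close 1 ltr01.
  exists ((n0.+1%:R + w n0.+1) / w n0.+1) => i L.
  have := cl n0.+1 (leqnSn _) _ (mU i L); rewrite mul1r ler_distl => /andP[+ _].
  rewrite -/(q i L) -/(qY i L) -/w lerBlDr => h.
  have := level_mass_le mu T Y T_mp mY muY_fin n0.+1 _ (mU i L); rewrite -/(qY i L) => h'.
  rewrite mulrAC ler_pdivlMr// mulrC; apply: (le_trans h).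
  by rewrite mulrDl lerD2r.
- by move=> e e0; have [n0 cl] := close e e0; exists n0 => n n0n i L; exact: cl.
- have [C [K [N [C0 sweep]]]] := uniform_sweeping_mass mu T Y That T_mp mY muY_gt0 muY_fin tr sw.
  exists C, K, N; split => // n Nn i L; apply: le_trans (sweep n Nn _ (mU i L)) _.
  by under eq_bigr do rewrite iter_unvisited.
- by move=> m L; exact: level_mass_renewal.
Qed.

(** The ratio in the theorem is a product of eight factors that each tend to 1:
    here p is the probability, P, Q and C the powers with exponent alpha of
    M+1, n+1 and c(n), a = negbin (1+b) M and r = negbin (2-b) M. *)
Lemma factor_identity (F : fieldType)
    (p S C l1 l2 l3 l4 wM wn a r y b nb Mb P Q n1 M1 : F) :
  [/\ S != 0, C != 0, l1 != 0, l2 != 0 & [/\ l3 != 0, l4 != 0, wM != 0, wn != 0 &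
  [/\ a != 0, r != 0, y != 0, b != 0 & [/\ nb != 0, Mb != 0, P != 0, Q != 0 &
   n1 != 0 /\ M1 != 0]]]] ->
  p / (S * (C * l1 / l2)) =
  (wM / a * p / (y * r)) * (y * nb / wn / b) * (r * (a * (b / Mb)) / S) *
  (wn / (n1 / Q * l3)) * (M1 / P * l4 / wM) * (l3 / l1) * (l2 / l4) *
  (P / (Q * C) * (n1 / nb) * (Mb / M1)).
Proof.
move=> [S0 C0 L1 L2 [L3 L4 WM WN [A0 R0 Y0 B0 [NB MB P0 Q0 [N1 M10]]]]].
by field; do ?(apply/andP; split).
Qed.

Theorem theorem3p1 (R : realType) (d : measure_display) (X : measurableType d)
    (mu : {sigma_finite_measure set X -> \bar R}) (T : X -> X)
    (That : (X -> \bar R) -> X -> \bar R) (Y : set X)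
    (alpha : R) (l : R -> R) (H : X -> R) (c : nat -> R)
    (mu_infinite : mu setT = +oo%E)
    (mY : measurable Y) (muY_gt0 : (0 < mu Y)%E) (muY_fin : (mu Y < +oo)%E)
    (T_cempt : CEMPT mu T)
    (That_transfer : transfer_operator mu T That)
    (alpha_gt0 : 0 < alpha) (alpha_lt1 : alpha < 1)
    (l_sv : slowly_varying l)
    (w_equiv : asymp_equiv \oo (wandering_rate mu T Y)
                 (fun n => n%:R `^ (1 - alpha) * l n%:R))
    (sweeping : exists2 N : nat, (0 < N)%N &
       uniformly_sweeping mu That
         [set transfer_average mu T That Y n | n in [set n | (N <= n)%N]]
         (EFin \o \1_Y))
    (H_Loo : H \in Lfun mu +oo%E)
    (average_cvg :
       ('N[mu]_+oo [(fun x => transfer_average mu T That Y n x - (H x)%:E)])%E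
         @[n --> \oo] --> 0%E)
    (c_gt0 : forall n, 0 < c n)
    (c_cvg0 : c n @[n --> \oo] --> 0)
    (cn_cvgy : c n * n%:R @[n --> \oo] --> +oo) :
  asymp_equiv \oo
    (fun n => fine (mu_dens mu (EFin \o H)
       [set x | (last_visit T Y n x)%:R / n%:R <= c n]))
    (fun n => sin (pi * alpha) / (pi * alpha) *
       (c n `^ alpha * l n%:R / l (c n * n%:R))).
Proof.
have [T_mp _ _] := T_cempt.
pose w := wandering_rate mu T Y.
have w_gt0 : forall n, 0 < w n.+1 by exact: wandering_rate_gt0.
have w_ge0 : forall n, 0 <= w n by exact: wandering_rate_ge0.
have w_nd : nondecreasing_seq w by exact: wandering_rate_nd.
have y_ge0 n : 0 <= w n.+1 - w n by rewrite subr_ge0 w_nd.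
have y_noninc : forall m n, (m <= n)%N -> w n.+1 - w n <= w m.+1 - w m.
  exact: wandering_rate_concave.
pose b := 1 - alpha.
have b0 : 0 < b by rewrite subr_gt0.
have b1 : b < 1 by rewrite gtrBl.
have bb : 0 < b < 1 by rewrite b0.
have w_negbin := regular_variation_uniform w l b bb l_sv w_ge0 w_nd w_equiv.
have mH : measurable_fun setT H := set_mem (sub_Lfun_mfun H_Loo).
have asym := last_visit_asymptotics R d X mu T That Y b H T_mp mY muY_gt0 muY_fin
  That_transfer b0 b1 w_negbin sweeping mH average_cvg.
have [_ l0 _] := l_sv.
pose M n := Num.trunc (c n * n%:R).
have My : M n @[n --> \oo] --> \oo by exact: truncn_cvgy.
pose p n := fine (mu_dens mu (EFin \o H) (unvisited T Y (M n) (n - M n))).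
pose y n := w n.+1 - w n.
have y_asym := increment_asymp w b b0 b1 w_gt0 y_noninc w_negbin.
have y_gt0 : \forall n \near \oo, 0 < y n.
  have h0 : \forall n \near \oo, 0 < y n * (n%:R + b) / w n.+1 by exact: cvgr_gt y_asym _ b0.
  apply: filterS h0 => n h.
  rewrite lt_neqAle y_ge0 andbT; apply: contraTN h => /eqP <-.
  by rewrite !mul0r ltxx.
have c_lt (e : R) : 0 < e -> \forall n \near \oo, c n <= e.
  by move=> e0; have /cvgrPdist_le/(_ _ e0) := c_cvg0; apply: filterS => n;
    rewrite sub0r normrN gtr0_norm.
have cn0 n : 0 <= c n * n%:R by rewrite mulr_ge0// ltW.
have Mle n : (M n)%:R <= c n * n%:R by rewrite truncn_le.
have Mgt n : c n * n%:R < (M n).+1%:R by exact: truncnS_gt.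
have F1 : w (M n).+1 / negbin (1 + b) (M n) * p n / (y n * negbin (2 - b) (M n))
    @[n --> \oo] --> (1 : R).
  apply/cvgrPdist_le => e e0; have [k kP] := asym e e0.
  have kN : \forall m \near \oo, (k <= m)%N by exists k.
  have kM : \forall n \near \oo, (k <= M n)%N := My _ kN.
  have kc : \forall n \near \oo, c n <= k.+1%:R^-1 by apply: c_lt; rewrite invr_gt0.
  move: kM kc y_gt0; apply: filterS3 => n kMn kcn yn.
  have r0 : 0 < negbin (2 - b) (M n).
    by rewrite negbin_gt0// subr_gt0 (lt_trans b1)// ltr1n.
  have yr0 : 0 < y n * negbin (2 - b) (M n) by rewrite mulr_gt0.
  have kMn' : (k * M n <= n)%N.
    rewrite -(ler_nat R) natrM (@le_trans _ _ (k.+1%:R * (c n * n%:R)))//.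
      by rewrite ler_pM// ler_nat.
    by rewrite mulrA ler_piMl// -ler_pdivlMl// mulr1.
  have := kP _ _ kMn kMn'; rewrite -/(p n) -/w -/(y n) => h.
  rewrite distrC -(ler_pM2r yr0) -[X in _ * X <= _](gtr0_norm yr0) -normrM.
  by rewrite mulrBl mul1r divfK// gt_eqF.
have F2 : y n * (n%:R + b) / w n.+1 / b @[n --> \oo] --> (1 : R).
  rewrite -[X in _ --> X](divff (lt0r_neq0 b0)).
  by apply: cvgM => //; exact: cvg_cst.
pose S : R := sin (pi * alpha) / (pi * alpha).
have S0 : 0 < S.
  rewrite divr_gt0 ?mulr_gt0 ?pi_gt0// sin_gt0_pi// mulr_gt0 ?pi_gt0//=.
  by rewrite gtr_pMr ?pi_gt0.
have F3 : negbin (2 - b) (M n) * (negbin (1 + b) (M n) * (b / ((M n)%:R + b))) / S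
    @[n --> \oo] --> (1 : R).
  rewrite -[X in _ --> X](divff (lt0r_neq0 S0)); apply: cvgM; last exact: cvg_cst.
  have euler := cvg_comp _ _ My (euler_sine_product alpha (introT andP (conj alpha_gt0 alpha_lt1))).
  apply: cvg_trans euler; apply: near_eq_cvg; apply: nearW => n /=.
  rewrite -negbin_reflection; congr (_ * _); first by congr negbin; rewrite /b; ring.
  rewrite [1 + b]addrC negbin_shift ?lt0r_neq0// -/b.
  have Mb : (M n)%:R + b != 0 by rewrite lt0r_neq0// ltr_wpDl.
  by field; rewrite Mb lt0r_neq0.
have F4 : w n.+1 / (n.+1%:R `^ b * l n.+1%:R) @[n --> \oo] --> (1 : R).
  by rewrite (cvg_shiftS (fun n => w n / (n%:R `^ b * l n%:R))).
have F5 : (M n).+1%:R `^ b * l (M n).+1%:R / w (M n).+1 @[n --> \oo] --> (1 : R).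
  have F4M := cvg_comp _ _ My F4.
  have : (w (M n).+1 / ((M n).+1%:R `^ b * l (M n).+1%:R))^-1 @[n --> \oo] --> (1 : R).
    by rewrite -[X in _ --> X]invr1; apply: cvgV => //; exact: oner_neq0.
  by under eq_cvg do rewrite invf_div.
have F6 : l n.+1%:R / l n%:R @[n --> \oo] --> (1 : R).
  apply: (slowly_varying_ratio l (fun n => n.+1%:R) (fun n => n%:R)) => //.
    exact: cvgr_idn.
  exists 1%N => // n /= n1; apply/andP; split.
    by rewrite ler_pdivrMr// -natrM ler_nat muln2 -addnn (leq_trans (leqnSn n))// leq_addr.
  by rewrite -natrM ler_nat mul2n -addnn -addn1 leq_add2l.
have cn_ge1 : \forall n \near \oo, 1 <= c n * n%:R.
  by have /cvgryPge/(_ 1) := cn_cvgy.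
have F7 : l (c n * n%:R) / l (M n).+1%:R @[n --> \oo] --> (1 : R).
  apply: (slowly_varying_ratio l (fun n => c n * n%:R) (fun n => (M n).+1%:R)) => //.
    apply: (@ger_cvgy _ _ _ _ (fun n => c n * n%:R)) => //.
    by apply: nearW => n; exact: ltW.
  apply: filterS cn_ge1 => n n1; have := Mle n; have := Mgt n.
  rewrite -natr1 => h1 h2; apply/andP; split; last by have := ler0n R (M n); lra.
  by rewrite ler_pdivrMr//; lra.
have F8 : ((M n).+1%:R / (n.+1%:R * c n)) `^ alpha *
    (n.+1%:R / (n%:R + b)) * (((M n)%:R + b) / (M n).+1%:R) @[n --> \oo] --> (1 : R).
  rewrite [X in _ --> X](_ : _ = 1 * 1 * 1); last by rewrite !mulr1.
  apply: cvgM; [apply: cvgM|].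
  - apply: powR_cvg1 => //; first by move=> n; rewrite divr_gt0// mulr_gt0.
    have h1 : (M n).+1%:R / (c n * n%:R) @[n --> \oo] --> (1 : R).
      apply: (@squeeze_cvgr _ _ _ _ (fun=> 1) (fun n => 1 + (c n * n%:R)^-1)).
      + apply: filterS cn_ge1 => n n1.
        have n0 : 0 < c n * n%:R by exact: lt_le_trans n1.
        rewrite ler_pdivlMr// mul1r (ltW (Mgt n))/= ler_pdivrMr// mulrDl mul1r.
        by rewrite mulVf ?gt_eqF// -natr1 lerD2r.
      + exact: cvg_cst.
      + rewrite -[X in _ --> X]addr0; apply: cvgD; first exact: cvg_cst.
        apply/gtr0_cvgV0 => //; apply: filterS cn_ge1 => n; exact: lt_le_trans.
    have h2 := natr_shift_cvg1 1 0 (@ltr01 R).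
    have : (M n).+1%:R / (c n * n%:R) * ((n%:R + 0) / (n%:R + 1)) @[n --> \oo] --> (1 : R).
      by rewrite -[X in _ --> X]mulr1; exact: cvgM.
    apply: cvg_trans; apply: near_eq_cvg; apply: filterS cn_ge1 => n n1.
    have n0 : n%:R != 0 :> R.
      by apply: contraTneq n1 => ->; rewrite mulr0 -ltNge ltr01.
    have c0 : c n != 0 by rewrite gt_eqF.
    by rewrite addr0 natr1; field; rewrite ?n0 ?c0 ?nat1r ?pnatr_eq0.
  - have := natr_shift_cvg1 b 1 b0; apply: cvg_trans; apply: near_eq_cvg.
    by apply: nearW => n; rewrite natr1.
  - have := cvg_comp _ _ My (natr_shift_cvg1 1 b (@ltr01 R)).
    apply: cvg_trans; apply: near_eq_cvg.
    by apply: nearW => n /=; rewrite natr1.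
have FF : w (M n).+1 / negbin (1 + b) (M n) * p n / (y n * negbin (2 - b) (M n)) *
    (y n * (n%:R + b) / w n.+1 / b) *
    (negbin (2 - b) (M n) * (negbin (1 + b) (M n) * (b / ((M n)%:R + b))) / S) *
    (w n.+1 / (n.+1%:R `^ b * l n.+1%:R)) *
    ((M n).+1%:R `^ b * l (M n).+1%:R / w (M n).+1) *
    (l n.+1%:R / l n%:R) * (l (c n * n%:R) / l (M n).+1%:R) *
    (((M n).+1%:R / (n.+1%:R * c n)) `^ alpha *
      (n.+1%:R / (n%:R + b)) * (((M n)%:R + b) / (M n).+1%:R)) @[n --> \oo] --> (1 : R).
  rewrite [X in _ --> X](_ : _ = 1 * 1 * 1 * 1 * 1 * 1 * 1 * 1); last by rewrite !mulr1.
  by do 7 (apply: cvgM => //).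
rewrite /asymp_equiv; apply: (cvg_near_eq _ _ _ FF).
have c_le1 := c_lt 1 ltr01.
have n_gt0 : \forall n \near \oo, (0 < n)%N by exists 1%N.
near=> n.
have yn : 0 < y n by near: n.
have n0 : (0 < n)%N by near: n.
have cn1 : c n <= 1 by near: n.
have Rn0 : 0 < n%:R :> R by rewrite ltr0n.
rewrite last_visit_fraction_le//; last by rewrite ltW.
rewrite -/(M n) -/(p n) -/S.
have powb (m : nat) : m.+1%:R `^ b = m.+1%:R / m.+1%:R `^ alpha :> R.
  by rewrite /b powRB ?powRr1// pnatr_eq0 implybT.
rewrite !powb powR_div// ?mulr_ge0 ?ltW// powRM ?ltW//.
apply: factor_identity.
have cn_gt0 : 0 < c n * n%:R by rewrite mulr_gt0.
have r0 : negbin (2 - b) (M n) != 0.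
  by rewrite gt_eqF// negbin_gt0// subr_gt0 (lt_trans b1)// ltr1n.
have a0 : negbin (1 + b) (M n) != 0 by rewrite gt_eqF// negbin_gt0// addr_gt0.
have nb0 (m : nat) : m%:R + b != 0 by rewrite gt_eqF// ltr_wpDl.
do ![split]; rewrite ?(gt_eqF S0) ?(gt_eqF b0) ?(gt_eqF yn) ?nb0 ?pnatr_eq0//.
all: by rewrite gt_eqF// ?powR_gt0// ?w_gt0// l0.
Unshelve. all: by end_near. Qed.
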